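(* Let $H^2$ be the Drury-Arveson space in infinitely many variables. If $\mathcal{M}$ is a nonzero submodule of $H^2$ of finite rank, then $\mathcal{M}=H^2$.
   Context: $\mathbb{B}$ is the open unit ball of $\ell^2$. $H^2$ is the reproducing kernel Hilbert space of holomorphic functions on $\mathbb{B}$ with kernel $\mathcal{K}_\lambda(z)=\frac1{1-\langle z,\lambda\rangle}$, $\lambda\in\mathbb{B}$. $M_i=M_{z_i}$ is multiplication by the $i$-th coordinate function. A submodule $\mathcal{M}$ of $H^2$ is a closed subspace invariant under all $M_i$, $i\ge1$. With $T_i=M_i|_{\mathcal{M}}$, the defect operator of $\mathcal{M}$ is $\Delta_{\mathcal{M}}=(I_{\mathcal{M}}-\text{SOT-}\lim_{k\to\infty}\sum_{i=1}^kT_iT_i^* )^{1/2}$, and the rank of $\mathcal{M}$ is $\dim\operatorname{ran}\Delta_{\mathcal{M}}$. *)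

(* Defs.v *)
From HB Require Import structures.
From mathcomp Require Import all_boot all_order all_algebra complex.
From mathcomp Require Import all_classical all_reals all_analysis.

Set Implicit Arguments.
Unset Strict Implicit.
Unset Printing Implicit Defensive.

Import Order.TTheory GRing.Theory Num.Theory.
Import numFieldNormedType.Exports.

Local Open Scope classical_set_scope.
Local Open Scope ring_scope.
Local Open Scope complex_scope.

(* The topology on the complex numbers [R[i]] is the one carried by the regular
   module [R[i]^o]. *)

Definition l2 (R : realType) : set (nat -> R[i]) :=
  [set z | cvgn (series (fun n => `|z n| ^+ 2) : nat -> R[i]^o)].

(* Linear in the first variable; only meaningful for sequences in [l2]. *)
Definition l2_dot (R : realType) (z w : nat -> R[i]) : R[i] :=
  limn (series (fun n => z n * Num.conj (w n)) : nat -> R[i]^o).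

Definition l2_norm (R : realType) (z : nat -> R[i]) : R[i] := sqrtC (l2_dot z z).

Definition unit_ball (R : realType) : set (nat -> R[i]) :=
  [set z | l2 z /\ l2_norm z < 1].

Arguments unit_ball R : clear implicits.

(* Holomorphic means complex Frechet differentiable at every point of the ball;
   [L] is the differential at [z], a bounded linear functional on [l2]. *)
Definition holomorphic (R : realType) (f : unit_ball R -> R[i]) : Prop :=
  forall z : unit_ball R, exists L : (nat -> R[i]) -> R[i],
    [/\ forall (a : R[i]) (u v : nat -> R[i]), l2 u -> l2 v ->
          L (fun n => a * u n + v n) = a * L u + L v,
        exists c : R[i], forall u, l2 u -> `|L u| <= c * l2_norm u
      & forall e : R[i], 0 < e -> exists2 d : R[i], 0 < d &
          forall w : unit_ball R,
            let h := fun n => \val w n - \val z n in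
            l2_norm h < d -> `|f w - f z - L h| <= e * l2_norm h].

(* A Hilbert space of complex functions on [X] with reproducing kernel [K],
   where [K w] is the kernel function at [w].  By Moore-Aronszajn, [K]
   determines such a space up to a unitary compatible with [rkhs_fun]. *)
Record rkhs (R : realType) (X : Type) (K : X -> X -> R[i]) := RKHS {
  rkhs_space :> completeNormedModType R[i];
  rkhs_dot : {dot rkhs_space for Num.conj};
  rkhs_normE : forall f : rkhs_space, `|f| ^+ 2 = rkhs_dot f f;
  rkhs_fun : {linear rkhs_space -> (X -> R[i]^o)};
  rkhs_fun_inj : injective rkhs_fun;
  rkhs_kernel : X -> rkhs_space;
  rkhs_kernelE : forall w z : X, rkhs_fun (rkhs_kernel w) z = K w z;
  rkhs_reproducing : forall (f : rkhs_space) (w : X),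
    rkhs_fun f w = rkhs_dot f (rkhs_kernel w)
}.

Arguments rkhs_dot {R X K} _.
Arguments rkhs_fun {R X K} _.
Arguments rkhs_kernel {R X K} _.

Definition da_kernel (R : realType) (w z : unit_ball R) : R[i] :=
  (1 - l2_dot (\val z) (\val w))^-1.

(* The Drury-Arveson space in infinitely many variables. *)
Record drury_arveson (R : realType) := DruryArveson {
  da_rkhs :> rkhs (@da_kernel R);
  da_holomorphic : forall f : da_rkhs, holomorphic (rkhs_fun da_rkhs f)
}.

(* Linear operators on a subspace [M] of a Hilbert space [H] are represented by
   functions [H -> H] of which only the restriction to [M] matters. *)
Section OperatorsOnSubspace.
Context (R : realType) (X : Type) (K : X -> X -> R[i]) (H : rkhs K).
Implicit Types (M V : set H) (T D : H -> H).
Local Notation "''[' f , g ]" := (rkhs_dot H f g).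

Definition closed_subspace M : Prop :=
  [/\ closed M, M 0
    & forall (a : R[i]) (f g : H), M f -> M g -> M (a *: f + g)].

Definition bounded_operator M T : Prop :=
  [/\ forall f, M f -> M (T f),
      forall (a : R[i]) (f g : H), M f -> M g -> T (a *: f + g) = a *: T f + T g
    & exists c : R[i], forall f, M f -> `|T f| <= c * `|f|].

Definition positive_operator M T : Prop :=
  bounded_operator M T /\ forall f, M f -> 0 <= '[T f, f].

(* The adjoint of [T : M -> M]: the vector of [M] representing [f |-> '[T f, g]],
   which exists and is unique when [T] is a bounded operator on [M]. *)
Definition adjoint M T (g : H) : H :=
  xget 0 [set h | M h /\ forall f, M f -> '[T f, g] = '[f, h]].

Definition is_sot_lim M (A : nat -> H -> H) T : Prop :=
  forall f, M f -> (fun k => A k f) @ \oo --> T f.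

Definition is_positive_sqrt M T D : Prop :=
  positive_operator M D /\ forall f, M f -> D (D f) = T f.

Definition has_dim V (n : nat) : Prop :=
  exists e : 'I_n -> H,
    (forall c : 'I_n -> R[i], \sum_(i < n) c i *: e i = 0 -> forall i, c i = 0)
    /\ V = [set v | exists c : 'I_n -> R[i], v = \sum_(i < n) c i *: e i].

End OperatorsOnSubspace.

Section Submodules.
Context (R : realType) (H : drury_arveson R).
Implicit Types (M : set H) (D : H -> H).

Definition is_coord_mul (i : nat) (f h : H) : Prop :=
  forall z : unit_ball R, rkhs_fun H h z = \val z i * rkhs_fun H f z.

(* [is_coord_mul i f] has at most one element, since [rkhs_fun] is injective. *)
Definition coord_mul (i : nat) (f : H) : H := xget 0 [set h | is_coord_mul i f h].

(* Invariance is stated as "the function z_i f belongs to M", which entails that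
   [coord_mul i f] is that function for [f] in [M]. *)
Definition submodule M : Prop :=
  closed_subspace M /\
  forall (i : nat) (f : H), M f -> exists2 h, M h & is_coord_mul i f h.

Definition is_defect_operator M D : Prop :=
  exists2 S : H -> H,
    is_sot_lim M
      (fun k f => \sum_(i < k) coord_mul i (adjoint M (coord_mul i) f)) S
    & is_positive_sqrt M (fun f => f - S f) D.

Definition has_rank M (n : nat) : Prop :=
  exists2 D : H -> H, is_defect_operator M D & has_dim (D @` M) n.

Definition finite_rank M : Prop := exists n : nat, has_rank M n.

End Submodules.

(* Main.v *)
Require Import Defs.
From mathcomp Require Import all_boot all_order all_algebra complex.
From mathcomp Require Import all_classical all_reals all_analysis.
From mathcomp Require Import ring lra.

(* Let [P] be the projection onto [M], [Q = 1 - P], and let [B_i] be the adjoint of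
   multiplication by [z_i].  The kernel makes [(B_0, B_1, ...)] a contraction from [H]
   to sequences in [H], and comparing this with the definition of the defect [D] gives
   [|Q B_i x|^2 <= |Q x|^2 + |D P x|^2].  As [D] has finite rank, [D P] kills weakly
   null sequences: if [x_i] is weakly null against [M] and [|Q x_i| -> 0], then
   [|Q B_l(i) x_i| -> 0] for all indices [l(i)].  For [e] in [M] this applies to
   [z_i e] and to the images of this sequence under polynomials in the [B_l].

   If [M] were orthogonal to the constants, then for [e = P K_w] the Taylor coefficients
   at [0] of [B_i z_i e] would tend to [0], hence so would
   [|z_i e|^2 = <B_i z_i e, e>], which is close to [(B_i z_i e)(w)]; evaluation of
   [z_i e] at [w + t e_i] then forces [e(w) = 0], and [M = 0].

   So [e = P 1] is nonzero, and [|z_i e|^2 = <B_i z_i e, P 1>] is close to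
   [(B_i z_i e)(0) = e(0) = |e|^2].  Hence [B_i z_i e -> e], and
   [|B_i z_i e|^2 + |B_l z_i e|^2 <= |z_i e|^2] gives [|e|^2 + |B_l e|^2 <= |e|^2] in
   the limit, because [B_i] and [B_l] commute.  Thus all [B_l e] vanish, [e] is a
   nonzero constant in [M], and [M] is the whole space. *)

Set Implicit Arguments.
Unset Strict Implicit.
Unset Printing Implicit Defensive.

Import Order.TTheory GRing.Theory Num.Theory.
Import numFieldNormedType.Exports.

Local Open Scope classical_set_scope.
Local Open Scope ring_scope.
Local Open Scope complex_scope.

(** * Real-valued norms and convergence in norm *)

Section RealNorm.
Context (R : realType).

(** The norm over [R[i]] is itself a complex number; its real part allows limits, square roots and
    linear arithmetic to be carried out in [R]. *)
Definition nrm (V : normedZmodType R[i]) (x : V) : R := complex.Re `|x|.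

Section Zmod.
Context (V : normedZmodType R[i]).
Implicit Types x y z : V.

Lemma nrmE x : (nrm x)%:C = `|x|.
Proof. by rewrite RRe_real// normr_real. Qed.

Lemma nrm_le x (a : R) : (`|x| <= a%:C) = (nrm x <= a).
Proof. by rewrite -nrmE lecR. Qed.

Lemma nrm_lt x (a : R) : (`|x| < a%:C) = (nrm x < a).
Proof. by rewrite -nrmE ltcR. Qed.

Lemma nrm_ge0 x : 0 <= nrm x.
Proof. by rewrite -ler0c nrmE. Qed.

Lemma nrmD x y : nrm (x + y) <= nrm x + nrm y.
Proof. by rewrite -lecR rmorphD/= !nrmE ler_normD. Qed.

Lemma nrmN x : nrm (- x) = nrm x.
Proof. by rewrite /nrm normrN. Qed.

Lemma nrm_distC x y : nrm (x - y) = nrm (y - x).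
Proof. by rewrite /nrm distrC. Qed.

Lemma nrmB x y : nrm (x - y) <= nrm x + nrm y.
Proof. by rewrite -(nrmN y) nrmD. Qed.

Lemma nrm_dist z x y : nrm (x - y) <= nrm (x - z) + nrm (z - y).
Proof. by have := nrmD (x - z) (z - y); rewrite addrA subrK. Qed.

Lemma nrm0 : nrm (0 : V) = 0.
Proof. by rewrite /nrm normr0. Qed.

Lemma nrm_eq0 x : nrm x = 0 -> x = 0.
Proof. by move=> x0; apply/eqP; rewrite -normr_eq0 -nrmE x0. Qed.

Lemma nrm_sum I (s : seq I) (P : pred I) (F : I -> V) :
  nrm (\sum_(i <- s | P i) F i) <= \sum_(i <- s | P i) nrm (F i).
Proof.
elim/big_ind2 : _ => //; first by rewrite nrm0.
by move=> x a y b xa yb; rewrite (le_trans (nrmD _ _))// lerD.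
Qed.

End Zmod.

Lemma nrmM (a b : R[i]) : nrm (a * b) = nrm a * nrm b.
Proof. by apply: complexI; rewrite rmorphM/= !nrmE normrM. Qed.

Lemma nrmC (a : R[i]) : nrm (Num.conj a) = nrm a.
Proof. by rewrite /nrm norm_conjC. Qed.

Lemma nrm_real (a : R) : nrm (a%:C) = `|a|.
Proof. by rewrite /nrm normc_def/= expr0n/= addr0 sqrtr_sqr. Qed.

Lemma nrm_Re (a : R[i]) : `|complex.Re a| <= nrm a.
Proof. by rewrite -lecR nrmE normc_ge_Re. Qed.

Lemma nrmZ (V : normedModType R[i]) (a : R[i]) (x : V) :
  nrm (a *: x) = nrm a * nrm x.
Proof. by apply: complexI; rewrite rmorphM/= !nrmE normrZ. Qed.

Lemma nrm_cvg (V : normedModType R[i]) (u : nat -> V) (l : V) :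
  (u @ \oo --> l) <-> ((fun n => nrm (u n - l)) @ \oo --> (0 : R)).
Proof.
split=> [ul|ul].
  apply/cvgr0Pnorm_lt => e e0; have e0' : 0 < e%:C by rewrite ltcR.
  move/cvgrPdist_lt : ul => /(_ _ e0'); apply: filterS => n.
  by rewrite distrC nrm_lt ger0_norm ?nrm_ge0.
apply/cvgrPdist_lt => e e0.
have eE : e = (complex.Re e)%:C by rewrite RRe_real// gtr0_real.
have e0' : 0 < complex.Re e by rewrite -ltcR -eE.
move/cvgr0Pnorm_lt : ul => /(_ _ e0'); apply: filterS => n.
by rewrite distrC {2}eE nrm_lt ger0_norm ?nrm_ge0.
Qed.

Lemma nrm_complete (V : completeNormedModType R[i]) (u : nat -> V) :
  (forall e : R, 0 < e -> exists N, forall m n, (N <= m)%N -> (N <= n)%N ->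
     nrm (u m - u n) <= e) ->
  exists l, (fun n => nrm (u n - l)) @ \oo --> (0 : R).
Proof.
move=> u_cauchy; suff cu : cvgn u by exists (limn u); apply/nrm_cvg.
apply/cauchy_cvgP/cauchy_exP => e e0.
have eE : e = (complex.Re e)%:C by rewrite RRe_real// gtr0_real.
have e0' : 0 < complex.Re e / 2 by rewrite divr_gt0// -ltcR -eE.
have [N HN] := u_cauchy _ e0'.
exists (u N); exists N => //= n Nn; rewrite -ball_normE/= eE nrm_lt.
by rewrite (le_lt_trans (HN _ _ (leqnn _) Nn))// ltr_pdivrMr//; lra.
Qed.

Lemma closed_nrm (V : completeNormedModType R[i]) (M : set V) (u : nat -> V) l :
  closed M -> (forall n, M (u n)) ->
  (fun n => nrm (u n - l)) @ \oo --> (0 : R) -> M l.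
Proof.
by move=> cM Mu /nrm_cvg ul; apply: (@closed_cvg _ _ _ _ _ M cM _ _ ul); exact: nearW.
Qed.

End RealNorm.

(** * Limits of real sequences *)

Section RealSequences.
Context (R : realType).
Implicit Types a b c : nat -> R.

Lemma cvg0_le a b : (forall n, 0 <= a n <= b n) ->
  b @ \oo --> (0 : R) -> a @ \oo --> (0 : R).
Proof.
by move=> ab b0; apply: (squeeze_cvgr _ (cvg_cst _) b0); exact: nearW.
Qed.

Lemma cvg_dist_le a b (l : R) : (forall n, `|a n - l| <= b n) ->
  b @ \oo --> (0 : R) -> a @ \oo --> l.
Proof.
move=> ab b0; apply/cvgrPdist_lt => e e0.
move/cvgr0Pnorm_lt : b0 => /(_ _ e0); apply: filterS => n be.
by rewrite distrC (le_lt_trans (ab n))// (le_lt_trans (ler_norm _)).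
Qed.

Lemma cvg0D a b : a @ \oo --> (0 : R) -> b @ \oo --> (0 : R) ->
  (fun n => a n + b n) @ \oo --> (0 : R).
Proof. by move=> a0 b0; rewrite -[0 in X in _ --> X]addr0; exact: cvgD. Qed.

Lemma cvg0_sqr a : (forall n, 0 <= a n) ->
  (fun n => a n ^+ 2) @ \oo --> (0 : R) -> a @ \oo --> (0 : R).
Proof.
move=> a0 sq0; have : Num.sqrt \o (fun n => a n ^+ 2) @ \oo --> Num.sqrt (0 : R).
  by apply: continuous_cvg sq0; exact: sqrt_continuous.
by rewrite sqrtr0; apply: cvg0_le => n /=; rewrite a0 sqrtr_sqr ler_norm.
Qed.

Lemma cvg0Ml (k : R) a : a @ \oo --> (0 : R) -> (fun n => k * a n) @ \oo --> (0 : R).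
Proof. by move=> a0; rewrite -[0 in X in _ --> X](mulr0 k); apply: cvgMl_tmp. Qed.

Lemma cvg_sum_ord (n : nat) (f : 'I_n -> nat -> R) (l : 'I_n -> R) :
  (forall i, f i @ \oo --> l i) ->
  (fun k => \sum_(i < n) f i k) @ \oo --> \sum_(i < n) l i.
Proof.
elim: n f l => [|n IH] f l fl.
  by under eq_fun do rewrite big_ord0; rewrite big_ord0; exact: cvg_cst.
under eq_fun do rewrite big_ord_recr/=; rewrite big_ord_recr/=.
by apply: cvgD => //; exact: IH.
Qed.

Lemma cvg0_sum (n : nat) (f : 'I_n -> nat -> R) :
  (forall i, f i @ \oo --> (0 : R)) ->
  (fun k => \sum_(i < n) f i k) @ \oo --> (0 : R).
Proof. by move=> /cvg_sum_ord; rewrite big1. Qed.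

Lemma cvg_nrm_dist (V : normedZmodType R[i]) (u : nat -> V) (l : V) :
  (fun n => nrm (u n - l)) @ \oo --> (0 : R) -> (fun n => nrm (u n)) @ \oo --> nrm l.
Proof.
apply: cvg_dist_le => n; rewrite ler_norml.
have := nrmD (u n - l) l; have := nrmD (l - u n) (u n); rewrite !subrK (nrm_distC l).
by move: (nrm _) (nrm _) (nrm _) => a b c; lra.
Qed.

Lemma cvg_ge_cst a (l k : R) : a @ \oo --> l -> (forall n, k <= a n) -> k <= l.
Proof.
by move=> al ak; apply: (ler_cvg_to (cvg_cst k) al); exact: nearW.
Qed.

(** Applied with [k] the length of a truncated expansion: the remainder [c k] is small uniformly in
    [i], so [k] is fixed first and [i] grows afterwards. *)
Lemma cvg0_approx a (b : nat -> nat -> R) c : (forall i, 0 <= a i) ->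
  (forall k i, a i <= b k i + c k) -> (forall k, b k @ \oo --> (0 : R)) ->
  c @ \oo --> (0 : R) -> a @ \oo --> (0 : R).
Proof.
move=> a0 ab b0 c0; apply/cvgr0Pnorm_lt => e e0; have e2 : 0 < e / 2 by rewrite divr_gt0.
move/cvgr0Pnorm_lt : c0 => /(_ _ e2)[k _ /(_ k (leqnn k)) ck].
move/cvgr0Pnorm_lt : (b0 k) => /(_ _ e2); apply: filterS => i bi.
rewrite ger0_norm//; apply: le_lt_trans (ab k i) _.
by have := ler_norm (b k i); have := ler_norm (c k); lra.
Qed.

(** Lets the size [t] of a perturbation of a point of the ball shrink to zero. *)
Lemma le0_of_small (x C d : R) : 0 < d -> (forall t, 0 < t < d -> x <= C * t) -> x <= 0.
Proof.
move=> d0 xC; pose t n := d / 2 * n.+1%:R^-1.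
have t0 : t @ \oo --> (0 : R) by apply: cvg0Ml; exact: cvg_harmonic.
apply: cvg_ge_cst (cvg0Ml C t0) _ => n; apply: xC.
have n0 : 0 < (n.+1%:R^-1 : R) by rewrite invr_gt0.
have n1 : (n.+1%:R^-1 : R) <= 1 by rewrite invf_le1// ler1n.
by rewrite /t; move: (n.+1%:R^-1) n0 n1 => r r0 r1; apply/andP; split; nra.
Qed.

End RealSequences.

(** * Inner products and orthogonal projections *)

Section Hilbert.
Context (R : realType) (H : completeNormedModType R[i]).
Context (dot : {dot H for Num.conj}) (normE : forall f : H, `|f| ^+ 2 = dot f f).
Local Notation "''[' f , g ]" := (dot f g).
Implicit Types (f g h : H) (V : set H).

Lemma dotDl f g h : '[f + g, h] = '[f, h] + '[g, h].
Proof. exact: linearDl. Qed.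
Lemma dotZl a f g : '[a *: f, g] = a * '[f, g].
Proof. exact: linearZl_LR. Qed.
Lemma dotBl f g h : '[f - g, h] = '[f, h] - '[g, h].
Proof. exact: linearBl. Qed.
Lemma dot0l f : '[0, f] = 0.
Proof. exact: linear0l. Qed.
Lemma dotC f g : '[f, g] = Num.conj '[g, f].
Proof. by rewrite hermC/= expr0 mul1r. Qed.
Lemma dotDr f g h : '[f, g + h] = '[f, g] + '[f, h].
Proof. by rewrite dotC dotDl rmorphD/= -!dotC. Qed.
Lemma dotZr a f g : '[f, a *: g] = Num.conj a * '[f, g].
Proof. by rewrite dotC dotZl rmorphM/= -dotC. Qed.
Lemma dot0r f : '[f, 0] = 0.
Proof. by rewrite dotC dot0l rmorph0. Qed.

Lemma dot_nrm f : '[f, f] = (nrm f ^+ 2)%:C.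
Proof. by rewrite -normE rmorphXn/= nrmE. Qed.

Lemma nrm_dotff f : nrm '[f, f] = nrm f ^+ 2.
Proof. by rewrite dot_nrm nrm_real ger0_norm// sqr_ge0. Qed.

Lemma nrm_sqr f : nrm f ^+ 2 = complex.Re '[f, f].
Proof. by rewrite dot_nrm. Qed.

Lemma Re_conjC (a : R[i]) : complex.Re (Num.conj a) = complex.Re a.
Proof. by case: a. Qed.

Lemma nrm_sqrD f g :
  nrm (f + g) ^+ 2 = nrm f ^+ 2 + nrm g ^+ 2 + 2 * complex.Re '[f, g] :> R.
Proof.
rewrite !nrm_sqr dotDl !dotDr [in '[g, f]]dotC !raddfD/= Re_conjC; ring.
Qed.

Lemma nrm_sqrB f g :
  nrm (f - g) ^+ 2 = nrm f ^+ 2 + nrm g ^+ 2 - 2 * complex.Re '[f, g] :> R.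
Proof.
by rewrite nrm_sqrD nrmN -[X in '[f, X]]scaleN1r dotZr rmorphN1 mulN1r raddfN/=; ring.
Qed.

Lemma pythagoras f g : '[f, g] = 0 ->
  nrm (f + g) ^+ 2 = nrm f ^+ 2 + nrm g ^+ 2 :> R.
Proof. by move=> fg; rewrite nrm_sqrD fg/= mulr0 addr0. Qed.

Lemma line_proj f g : exists a : R[i], '[f - a *: g, g] = 0.
Proof.
have [->|g0] := eqVneq g 0; first by exists 0; rewrite dot0r.
exists ('[f, g] / '[g, g]); rewrite dotBl dotZl divfK ?subrr//.
by rewrite gt_eqF// dnorm_gt0.
Qed.

(** Cauchy-Schwarz, by Pythagoras applied to the projection of [f] on the line of [g]. *)
Lemma nrm_dot_le f g : nrm '[f, g] <= nrm f * nrm g.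
Proof.
have [a fag] := line_proj f g.
have fg : '[f, g] = a * '[g, g].
  by apply/eqP; rewrite -subr_eq0 -dotZl -dotBl fag.
have P : nrm f ^+ 2 = nrm (f - a *: g) ^+ 2 + (nrm a * nrm g) ^+ 2.
  by rewrite -nrmZ -pythagoras ?subrK// dotZr fag mulr0.
rewrite fg nrmM nrm_dotff expr2 mulrA ler_wpM2r ?nrm_ge0//.
rewrite -(@ler_pXn2r _ 2%N) ?nnegrE ?mulr_ge0 ?nrm_ge0// P.
by rewrite lerDr sqr_ge0.
Qed.

Definition seq_closed V := forall (u : nat -> H) l, (forall n, V (u n)) ->
  (fun n => nrm (u n - l)) @ \oo --> (0 : R) -> V l.

Definition linear_set V :=
  V 0 /\ forall (a : R[i]) f g, V f -> V g -> V (a *: f + g).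

(** A minimizing sequence for the distance from [f] to [V] is Cauchy by the parallelogram law, and
    its limit is the projection. *)
Lemma projection_exists V : linear_set V -> seq_closed V ->
  forall f, exists p, V p /\ forall g, V g -> '[f - p, g] = 0.
Proof.
move=> [V0 VL] Vc f.
have VD g h : V g -> V h -> V (g + h).
  by move=> Vg Vh; rewrite -[g]scale1r; exact: VL.
have VZ a g : V g -> V (a *: g) by move=> Vg; rewrite -[_ *: _]addr0; exact: VL.
pose E := [set nrm (f - m) ^+ 2 | m in V].
have E0 : E !=set0 by exists (nrm (f - 0) ^+ 2), 0.
have lbE : lbound E 0 by move=> _ [m _ <-]; exact: sqr_ge0.
pose d := inf E.
have dE m : V m -> d <= nrm (f - m) ^+ 2.
  by move=> Vm; apply: ge_inf; [exists 0|exists m].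
have /choice[m /all_and2[Vm md]] n : exists m, V m /\ nrm (f - m) ^+ 2 < d + n.+1%:R^-1.
  have [|_ [m Vm <-] mlt] := @inf_adherent R E n.+1%:R^-1 _ (conj E0 (ex_intro _ 0 lbE)).
    by rewrite invr_gt0.
  by exists m.
(* Parallelogram law for [f - m i] and [f - m j]: the midpoint of [m i] and [m j] is in [V], so its
   squared distance to [f] is at least [d]. *)
have par i j : nrm (m i - m j) ^+ 2 <= 2 * i.+1%:R^-1 + 2 * j.+1%:R^-1.
  have /dE : V (2^-1 *: (m i + m j)) by apply/VZ/VD.
  have e1 : f - m i - (f - m j) = - (m i - m j).
    by rewrite !opprB addrC addrA addrNK.
  have e2 : f - m i + (f - m j) = (2 : R[i]) *: (f - 2^-1 *: (m i + m j)).
    by rewrite scalerBr scalerA divff// scale1r scaler_nat mulr2n opprD addrACA.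
  have := nrm_sqrD (f - m i) (f - m j); have := nrm_sqrB (f - m i) (f - m j).
  rewrite e1 e2 nrmN nrmZ exprMn.
  have -> : nrm (2 : R[i]) = 2.
    by rewrite -[2]/(2%:R) -(rmorph_nat (real_complex R)) nrm_real ger0_norm.
  have := md i; have := md j.
  move: (i.+1%:R^-1) (j.+1%:R^-1) (nrm (_ - m j) ^+ 2) (nrm (_ - m i) ^+ 2).
  move=> x y a b; move: (nrm (_ - _ *: _) ^+ 2) (nrm _ ^+ 2) => c e; lra.
have [p mp] : exists p, (fun n => nrm (m n - p)) @ \oo --> (0 : R).
  apply: nrm_complete => e e0.
  have [N Ne] : exists N : nat, N.+1%:R^-1 < e ^+ 2 / 4.
    have e4 : 0 < e ^+ 2 / 4 by rewrite divr_gt0// exprn_gt0.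
    have := near_infty_natSinv_lt (PosNum e4).
    by case=> N _ /(_ N (leqnn N)) HN; exists N.
  exists N => i j Ni Nj; rewrite -(@ler_pXn2r _ 2%N) ?nnegrE ?nrm_ge0 ?(ltW e0)//.
  have le_inv k : (N <= k)%N -> (k.+1%:R^-1 : R) <= N.+1%:R^-1.
    by move=> Nk; rewrite lef_pV2 ?posrE// ler_nat.
  apply: le_trans (par i j) _; have := le_inv _ Ni; have := le_inv _ Nj.
  by move: Ne; move: (i.+1%:R^-1) (j.+1%:R^-1) (N.+1%:R^-1) => x y z; lra.
have Vp : V p by exact: Vc mp.
exists p; split=> // g Vg.
have dp : nrm (f - p) ^+ 2 <= d.
  have ub n : nrm (f - p) <= Num.sqrt (d + n.+1%:R^-1) + nrm (m n - p).
    rewrite (le_trans (nrm_dist (m n) _ _))// lerD2r.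
    rewrite -[leLHS]ger0_norm ?nrm_ge0// -sqrtr_sqr ler_sqrt ?(ltW (md n))//.
    by rewrite (le_trans _ (ltW (md n))) ?sqr_ge0.
  have d0 : 0 <= d by exact: lb_le_inf.
  suff : nrm (f - p) <= Num.sqrt d + 0.
    rewrite addr0 -[leLHS]ger0_norm ?nrm_ge0// -sqrtr_sqr.
    by rewrite ler_sqrt.
  have dlim : (fun n => d + n.+1%:R^-1) @ \oo --> d.
    by rewrite -[X in _ --> X]addr0; apply: cvgD; [exact: cvg_cst|exact: cvg_harmonic].
  have sqlim : Num.sqrt \o (fun n => d + n.+1%:R^-1) @ \oo --> Num.sqrt d.
    by apply: continuous_cvg dlim; exact: sqrt_continuous.
  exact: (cvg_ge_cst (cvgD sqlim mp) ub).
(* Moving [p] to [p + a *: g] would decrease the squared distance by [nrm (a *: g) ^+ 2], so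
   minimality forces [a *: g = 0]. *)
have [a fag] := line_proj (f - p) g.
have Vpag : V (p + a *: g) by apply: VD => //; exact: VZ.
have P : nrm (f - p) ^+ 2 = nrm (f - p - a *: g) ^+ 2 + nrm (a *: g) ^+ 2 :> R.
  by rewrite -pythagoras ?subrK// dotZr fag mulr0.
have : nrm (a *: g) ^+ 2 <= 0.
  by have := dE _ Vpag; rewrite opprD addrA; lra.
rewrite -[_ ^+ 2 <= 0]negbK -ltNge exprn_even_gt0//= negbK => /eqP/nrm_eq0 ag0.
by rewrite -(subrK (a *: g) (f - p)) dotDl fag ag0 dot0l addr0.
Qed.

End Hilbert.

(** * Projection operators, self-adjointness and finite rank *)

Section HilbertOperators.
Context (R : realType) (H : completeNormedModType R[i]).
Context (dot : {dot H for Num.conj}) (normE : forall f : H, `|f| ^+ 2 = dot f f).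
Local Notation "''[' f , g ]" := (dot f g).
Implicit Types (f g h : H) (V : set H).

Lemma dotff_eq0 f : '[f, f] = 0 -> f = 0.
Proof.
by rewrite (dot_nrm normE) => /complexI/eqP; rewrite sqrf_eq0 => /eqP/nrm_eq0.
Qed.

Section Projection.
Context (V : set H) (VL : linear_set V) (Vc : seq_closed V).

Definition oproj f : H := xget 0 [set p | V p /\ forall g, V g -> '[f - p, g] = 0].

Lemma projP f : V (oproj f) /\ forall g, V g -> '[f - oproj f, g] = 0.
Proof.
by rewrite /oproj; case: xgetP => // no; have [p /no] := projection_exists normE VL Vc f.
Qed.

Lemma proj_in f : V (oproj f). Proof. by case: (projP f). Qed.

Lemma proj_orth f g : V g -> '[f - oproj f, g] = 0.
Proof. by case: (projP f) => _; exact. Qed.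

Lemma linear_setB f g : V f -> V g -> V (f - g).
Proof. by case: VL => _ L Vf Vg; rewrite addrC -scaleN1r; exact: L. Qed.

Lemma proj_uniq f p : V p -> (forall g, V g -> '[f - p, g] = 0) -> oproj f = p.
Proof.
move=> Vp orth; apply/eqP; rewrite -subr_eq0; apply/eqP/dotff_eq0.
have Vd : V (oproj f - p) by apply: linear_setB => //; exact: proj_in.
have -> : '[oproj f - p, oproj f - p] =
    '[f - p, oproj f - p] - '[f - oproj f, oproj f - p].
  by rewrite -dotBl; congr (dot _ _); rewrite opprB [RHS]addrC addrA subrK.
by rewrite orth// proj_orth// subrr.
Qed.

Lemma proj_id f : V f -> oproj f = f.
Proof. by move=> Vf; apply: proj_uniq => // g _; rewrite subrr dot0l. Qed.

Lemma proj_dotl f g : V g -> '[oproj f, g] = '[f, g].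
Proof.
by move=> Vg; apply/esym/eqP; rewrite -subr_eq0 -dotBl proj_orth.
Qed.

Lemma proj_linear a f g : oproj (a *: f + g) = a *: oproj f + oproj g.
Proof.
apply: proj_uniq; first by case: VL => _; apply; exact: proj_in.
move=> h Vh; rewrite dotBl !dotDl !dotZl !proj_dotl// subrr //.
Qed.

Lemma nrm_proj f : nrm f ^+ 2 = nrm (oproj f) ^+ 2 + nrm (f - oproj f) ^+ 2 :> R.
Proof.
rewrite addrC -(pythagoras normE) ?subrK// proj_orth//; exact: proj_in.
Qed.

Lemma proj_eq0 f : (forall g, V g -> '[f, g] = 0) -> oproj f = 0.
Proof.
by move=> fV; apply: proj_uniq => [|g Vg]; [case: VL|rewrite subr0 fV].
Qed.

End Projection.

Lemma dot_suml I (s : seq I) (P : pred I) (F : I -> H) g :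
  '[\sum_(i <- s | P i) F i, g] = \sum_(i <- s | P i) '[F i, g].
Proof.
by apply: (big_morph (dot^~ g)) => [f h|]; [exact: dotDl|exact: dot0l].
Qed.

Lemma dot_sumr I (s : seq I) (P : pred I) (F : I -> H) g :
  '[g, \sum_(i <- s | P i) F i] = \sum_(i <- s | P i) '[g, F i].
Proof. by rewrite (big_morph (dot g) (dotDr dot g) (dot0r dot g)). Qed.

(* Invertibility of the Gram matrix of [e]. *)
Lemma dual_family n (e : 'I_n -> H) :
  (forall c : 'I_n -> R[i], \sum_(i < n) c i *: e i = 0 -> forall i, c i = 0) ->
  exists y : 'I_n -> H, forall c : 'I_n -> R[i], let v := \sum_(i < n) c i *: e i in
    v = \sum_(k < n) '[v, e k] *: y k.
Proof.
move=> e_free; pose G := \matrix_(i < n, k < n) '[e i, e k].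
have dotG (c : 'rV[R[i]]_n) k : '[\sum_(i < n) c 0 i *: e i, e k] = (c *m G) 0 k.
  by rewrite dot_suml mxE; apply: eq_bigr => i _; rewrite dotZl mxE.
have Gu : G \in unitmx.
  rewrite -row_free_unit; apply/inj_row_free => c cG.
  apply/rowP => i; rewrite mxE; move: i; apply: e_free; apply: dotff_eq0.
  by rewrite dot_sumr big1// => k _; rewrite dotZr dotG cG mxE mulr0.
exists (fun k => \sum_(i < n) invmx G k i *: e i) => c; pose r := \row_i c i.
have -> : \sum_(i < n) c i *: e i = \sum_(i < n) r 0 i *: e i.
  by apply: eq_bigr => i _; rewrite mxE.
move=> v; have rE : r = r *m G *m invmx G by rewrite mulmxK.
rewrite {1}/v [in LHS]rE; under [RHS]eq_bigr do rewrite scaler_sumr.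
rewrite exchange_big/=; apply: eq_bigr => i _.
rewrite mxE scaler_suml; apply: eq_bigr => k _.
by rewrite scalerA dotG.
Qed.

(** Positivity makes the quadratic form of [D] real, and polarization of [a *: f + g] with [a = 1]
    and [a = 'i] gives symmetry. *)
Lemma self_adjoint (M : set H) (D : H -> H) : linear_set M ->
  (forall (a : R[i]) f g, M f -> M g -> D (a *: f + g) = a *: D f + D g) ->
  (forall f, M f -> 0 <= '[D f, f]) ->
  forall f g, M f -> M g -> '[D f, g] = '[f, D g].
Proof.
move=> [M0 ML] DL D0 f g Mf Mg.
have diag h : M h -> '[D h, h] = '[h, D h].
  by move=> Mh; rewrite [RHS]dotC conj_Creal// ger0_real// D0.
have polar a : a * ('[D f, g] - '[f, D g]) + Num.conj a * ('[D g, f] - '[g, D f]) = 0.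
  have := diag _ (ML a f g Mf Mg).
  rewrite DL// !dotDl !dotDr !dotZl !dotZr -(diag f)// -(diag g)// => e.
  apply/eqP; move/eqP: e; rewrite -subr_eq0 => /eqP <-; apply/eqP; ring.
have p1 := polar 1; have pi := polar 'i%C.
move: p1 pi; rewrite rmorph1 !mul1r; set u := _ - _; set w := _ - _ => uw.
have -> : Num.conj ('i%C : R[i]) = - 'i%C by rewrite complexiE conjCi.
rewrite mulNr -mulrBr => /eqP; rewrite mulf_eq0 => /orP[/eqP|].
  by rewrite complexiE => /eqP; rewrite (negPf (neq0Ci _)).
move=> /eqP uw0; have : u *+ 2 = 0.
  by rewrite mulr2n -[X in _ + X](subrK w) uw0 add0r uw.
by move=> /eqP; rewrite mulrn_eq0/= subr_eq0 => /eqP.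
Qed.

(** With [y] the family from [dual_family], the coefficients of [D (x i)] along [y] are
    ['[D (x i), e k] = '[x i, D (e k)]]. There are finitely many, and each tends to zero because
    [D (e k)] is in [M]. *)
Lemma finite_rank_null (M : set H) (D : H -> H) n (e : 'I_n -> H) :
  (forall f, M f -> M (D f)) ->
  (forall f g, M f -> M g -> '[D f, g] = '[f, D g]) ->
  (forall c : 'I_n -> R[i], \sum_(i < n) c i *: e i = 0 -> forall i, c i = 0) ->
  D @` M = [set v | exists c : 'I_n -> R[i], v = \sum_(i < n) c i *: e i] ->
  forall x : nat -> H, (forall i, M (x i)) ->
    (forall q, M q -> (fun i => nrm '[x i, q]) @ \oo --> (0 : R)) ->
  (fun i => nrm (D (x i))) @ \oo --> (0 : R).
Proof.
move=> MD Dsym e_free DM x Mx xq; have [y yE] := dual_family e_free.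
have Me k : M (e k).
  have : (D @` M) (e k).
    rewrite DM; exists (fun i => (i == k)%:R).
    rewrite (bigD1 k)//= eqxx scale1r big1 ?addr0// => i /negPf ->.
    by rewrite scale0r.
  by case=> f Mf <-; exact: MD.
apply: (@cvg0_le _ _ (fun i => \sum_(k < n) nrm (y k) * nrm '[x i, D (e k)])).
  move=> i; rewrite nrm_ge0/=.
  have : (D @` M) (D (x i)) by exists (x i).
  rewrite DM => -[c /= Dc]; rewrite Dc yE -Dc.
  rewrite (le_trans (nrm_sum _ _ _))// ler_sum// => k _.
  by rewrite nrmZ mulrC Dsym.
apply: cvg0_sum => k; apply: cvg0Ml; apply: xq; exact: MD.
Qed.

End HilbertOperators.

(** * The unit ball of l2 *)

Section Ball.
Context (R : realType).
Implicit Types (z w h : nat -> R[i]) (N : nat).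

(** Points of finite support keep every sum over coordinates finite; by [holomorphic_fsupp0] they
    still determine holomorphic functions. *)
Definition fsupp N w := forall l, (N <= l)%N -> w l = 0.

Definition sqsum N w : R := \sum_(l < N) nrm (w l) ^+ 2.

Lemma sqsumS N w : sqsum N.+1 w = sqsum N w + nrm (w N) ^+ 2.
Proof. by rewrite /sqsum big_ord_recr. Qed.

Definition l2sq w : R := complex.Re (l2_dot w w).

Lemma series_cst (u : nat -> R[i]) N : (forall l, (N <= l)%N -> u l = 0) ->
  (series u : nat -> R[i]^o) @ \oo --> (\sum_(l < N) u l : R[i]^o).
Proof.
move=> u0; apply: cvg_near_cst; exists N => // n /= Nn.
rewrite /series/= (@big_cat_nat _ _ _ N)//= big_mkord.
rewrite [X in _ + X]big_nat_cond [X in _ + X]big1 ?addr0//.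
by move=> l /andP[/andP[Nl _] _]; rewrite u0.
Qed.

Lemma l2_dot_fsupp N z w : fsupp N z \/ fsupp N w ->
  l2_dot z w = \sum_(l < N) z l * Num.conj (w l).
Proof.
move=> zw; apply: (@cvg_lim R[i]^o); first exact: norm_hausdorff.
by apply: series_cst => l Nl; case: zw => ->//; rewrite ?mul0r// rmorph0 mulr0.
Qed.

Lemma l2_fsupp N w : fsupp N w -> l2 w.
Proof.
move=> wN; apply/cvg_ex; exists (\sum_(l < N) `|w l| ^+ 2).
by apply: series_cst => l Nl; rewrite wN// normr0 expr0n.
Qed.

Lemma sqsumE w n : series (fun n => `|w n| ^+ 2) n = (sqsum n w)%:C.
Proof.
rewrite /series/= big_mkord /sqsum rmorph_sum; apply: eq_bigr => l _.
by rewrite -nrmE rmorphXn.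
Qed.

Lemma sqsum_cvg w : l2 w -> sqsum^~ w @ \oo --> l2sq w /\ l2_dot w w = (l2sq w)%:C.
Proof.
move=> /cvg_ex[/= s ws].
have dots : l2_dot w w = s.
  apply: (@cvg_lim R[i]^o); first exact: norm_hausdorff.
  suff -> : (fun n => w n * Num.conj (w n)) = (fun n => `|w n| ^+ 2) by [].
  by apply/funext => n; rewrite normCK.
have {}ws : (fun n => nrm ((sqsum n w)%:C - s)) @ \oo --> (0 : R).
  have /nrm_cvg := ws.
  suff -> : (fun n => nrm (series (fun n => `|w n| ^+ 2) n - s)) =
    (fun n => nrm ((sqsum n w)%:C - s)) by [].
  by apply/funext => n; rewrite sqsumE.
split.
  apply: cvg_dist_le ws => n; rewrite /l2sq dots.
  by have := nrm_Re ((sqsum n w)%:C - s); rewrite raddfB.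
rewrite /l2sq dots [LHS]complexE.
(* The partial sums are real, so the imaginary part of [s] is bounded by their distance to [s];
   multiplication by ['i] turns it into a real part. *)
suff -> : complex.Im s = 0 by rewrite rmorph0 mulr0 addr0.
apply/eqP; rewrite -normr_le0; apply: cvg_ge_cst ws _ => n.
have := nrm_Re (((sqsum n w)%:C - s) * 'i%C).
by rewrite nrmM ReiNIm raddfB/= sub0r opprK /nrm complexiE normCi mulr1.
Qed.

Lemma sqsum_ge0 n w : 0 <= sqsum n w.
Proof. by apply: sumr_ge0 => l _; rewrite sqr_ge0. Qed.

Lemma sqsum_le n w : l2 w -> sqsum n w <= l2sq w.
Proof.
move=> /sqsum_cvg[ws _].
have nd : nondecreasing_seq (sqsum^~ w).
  apply/nondecreasing_seqP => k.
  by rewrite /sqsum big_ord_recr/= lerDl sqr_ge0.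
rewrite -(cvg_lim _ ws)//; apply: nondecreasing_cvgn_le => //.
by apply/cvg_ex; exists (l2sq w).
Qed.

Lemma l2sq_ge0 w : l2 w -> 0 <= l2sq w.
Proof. by move=> /(sqsum_le 0); exact: le_trans (sqsum_ge0 _ _). Qed.

Lemma l2_normE w : l2 w -> l2_norm w = (Num.sqrt (l2sq w))%:C.
Proof.
move=> lw; rewrite /l2_norm (sqsum_cvg lw).2.
rewrite -[in LHS](sqr_sqrtr (l2sq_ge0 lw)) rmorphXn/= sqrCK//.
by rewrite ler0c sqrtr_ge0.
Qed.

Lemma l2sq_fsupp N w : fsupp N w -> l2sq w = sqsum N w.
Proof.
move=> wN; rewrite /l2sq (@l2_dot_fsupp N); last by left.
rewrite raddf_sum; apply: eq_bigr => l _.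
by rewrite -normCK -nrmE -rmorphXn.
Qed.

Lemma ballP w : unit_ball R w <-> l2 w /\ l2sq w < 1.
Proof.
suff E : l2 w -> (l2_norm w < 1) = (l2sq w < 1).
  by split=> -[lw w1]; split=> //; [rewrite -E|rewrite E].
move=> lw; rewrite l2_normE// -[X in _ < X]/(1%:C) ltcR.
by rewrite -[X in _ < X]sqrtr1 ltr_sqrt.
Qed.

Lemma pt_exists N w : fsupp N w -> sqsum N w < 1 -> exists p : unit_ball R, \val p = w.
Proof.
move=> wN w1; have bw : unit_ball R w.
  by apply/ballP; split; [exact: l2_fsupp wN|rewrite (l2sq_fsupp wN)].
by exists (SigSub (mem_set bw)).
Qed.

Lemma ball_sqsum (p : unit_ball R) n : sqsum n (\val p) < 1.
Proof.
have /set_mem/ballP[lp p1] := valP p; exact: le_lt_trans (sqsum_le _ lp) p1.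
Qed.

Definition truncate N w : nat -> R[i] := fun l => if (l < N)%N then w l else 0.

Lemma fsupp_trunc N w : fsupp N (truncate N w).
Proof. by move=> l Nl; rewrite /truncate ltnNge Nl. Qed.

Lemma sqsum_trunc N w : sqsum N (truncate N w) = sqsum N w.
Proof. by apply: eq_bigr => l _; rewrite /truncate ltn_ord. Qed.

Lemma sqsum_fsupp N n w : fsupp N w -> (N <= n)%N -> sqsum n w = sqsum N w.
Proof.
move=> wN Nn; rewrite /sqsum -!(big_mkord xpredT (fun l => nrm (w l) ^+ 2)).
rewrite (@big_cat_nat _ _ _ N)//= [X in _ + X]big_nat_cond [X in _ + X]big1 ?addr0//.
by move=> l /andP[/andP[Nl _] _]; rewrite wN// nrm0 expr0n.
Qed.

Lemma l2_of_sqsum w (s : R) : sqsum^~ w @ \oo --> s -> l2 w /\ l2sq w = s.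
Proof.
move=> ws; have lw : l2 w.
  apply/cvg_ex; exists s%:C; apply/nrm_cvg.
  have -> : (fun n => nrm (series (fun n => `|w n| ^+ 2) n - s%:C)) =
    (fun n => `|sqsum n w - s|).
    by apply/funext => n; rewrite sqsumE -rmorphB/= nrm_real.
  have : (fun n => `|sqsum n w - s|) @ \oo --> `|s - s|.
    by apply: cvg_norm; apply: cvgB => //; exact: cvg_cst.
  by rewrite subrr normr0.
split=> //; have [ws' _] := sqsum_cvg lw.
by apply: cvg_unique ws' ws; exact: norm_hausdorff.
Qed.

Lemma sqsum_dist_trunc N w n : (N <= n)%N ->
  sqsum n (fun l => truncate N w l - w l) = sqsum n w - sqsum N w.
Proof.
move=> /subnKC <-; elim: (n - N)%N => [|k IH].
  rewrite addn0 subrr; apply: big1 => l _.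
  by rewrite /truncate ltn_ord subrr nrm0 expr0n.
rewrite addnS !sqsumS IH addrAC.
by rewrite /truncate ltnNge leq_addr/= sub0r nrmN.
Qed.

Lemma dist_trunc w : l2 w -> exists2 b : nat -> R, b @ \oo --> (0 : R) &
  forall N, let h := fun l => truncate N w l - w l in l2 h /\ l2sq h = b N.
Proof.
move=> lw; have [ws _] := sqsum_cvg lw.
exists (fun N => l2sq w - sqsum N w).
  by rewrite -[X in _ --> X](subrr (l2sq w)); apply: cvgB => //; exact: cvg_cst.
move=> N h; apply: l2_of_sqsum.
have cs : (fun n => sqsum n w - sqsum N w) @ \oo --> (l2sq w - sqsum N w).
  by apply: cvgB => //; exact: cvg_cst.
apply: cvg_trans cs; apply: near_eq_cvg; exists N => // n Nn.
by rewrite sqsum_dist_trunc.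
Qed.

(** The differentiability estimate with [e = 1] plus the bound on the differential. Holomorphy
    enters the proof only through this local bound. *)
Lemma holomorphic_lipschitz (f : unit_ball R -> R[i]) (w : unit_ball R) :
  holomorphic f -> exists C d : R, [/\ 0 <= C, 0 < d &
    forall w' : unit_ball R, let h := fun n => \val w' n - \val w n in
      l2 h -> Num.sqrt (l2sq h) < d ->
      nrm (f w' - f w) <= C * Num.sqrt (l2sq h)].
Proof.
move=> /(_ w)[L [_ [c Lc] /(_ 1 ltr01)[d d0 fd]]].
have dE : d = (complex.Re d)%:C by rewrite RRe_real// gtr0_real.
exists (1 + nrm c), (complex.Re d); split; rewrite ?addr_ge0 ?nrm_ge0//.
  by rewrite -ltcR -dE.
move=> w' h lh hd; set s := Num.sqrt (l2sq h).
have Lh : nrm (L h) <= nrm c * s.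
  have := Lc _ lh; rewrite l2_normE// lecE => /andP[_].
  rewrite -/(nrm (L h)) => /le_trans; apply.
  rewrite (le_trans (ler_norm _))// (le_trans (nrm_Re _))// nrmM nrm_real.
  by rewrite ger0_norm// sqrtr_ge0.
have : nrm (f w' - f w - L h) <= s.
  rewrite -nrm_le; have /= := fd w'; rewrite -/h l2_normE// mul1r; apply.
  by rewrite dE ltcR.
have := nrmD (f w' - f w - L h) (L h); rewrite subrK mulrDl mul1r.
by move=> /le_trans le1 le2; apply: le1; rewrite lerD.
Qed.

(** The truncations of [w] are points of finite support converging to [w] in [l2], and [f] is
    Lipschitz at [w]. *)
Lemma holomorphic_fsupp0 (f : unit_ball R -> R[i]) : holomorphic f ->
  (forall (p : unit_ball R) N, fsupp N (\val p) -> f p = 0) ->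
  forall w : unit_ball R, f w = 0.
Proof.
move=> hf f0 w; have /set_mem/ballP[lw w1] := valP w.
have [C [d [C0 d0 fC]]] := holomorphic_lipschitz w hf.
have [b b0 hb] := dist_trunc lw.
have sb0 : Num.sqrt \o b @ \oo --> (0 : R).
  by rewrite -[X in _ --> X]sqrtr0; apply: continuous_cvg b0; exact: sqrt_continuous.
apply: nrm_eq0; apply/eqP; rewrite eq_le nrm_ge0 andbT.
apply: (ler_cvg_to (cvg_cst _) (cvg0Ml C sb0)).
move/cvgr0Pnorm_lt : (sb0) => /(_ _ d0); apply: filterS => N bd.
have [p pE] : exists p : unit_ball R, \val p = truncate N (\val w).
  by apply: (pt_exists (@fsupp_trunc N _)); rewrite sqsum_trunc ball_sqsum.
have /= [lh hE] := hb N; have /= := fC p; rewrite pE hE => /(_ lh).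
rewrite (f0 _ N) ?pE; last exact: fsupp_trunc.
by rewrite sub0r nrmN; apply; exact: le_lt_trans (ler_norm _) bd.
Qed.

Lemma dot_lt1 N z w : sqsum N z < 1 -> sqsum N w < 1 ->
  nrm (\sum_(l < N) z l * Num.conj (w l)) < 1.
Proof.
move=> z1 w1; rewrite (le_lt_trans (nrm_sum _ _ _))//.
have : \sum_(l < N) nrm (z l * Num.conj (w l)) <= 2^-1 * (sqsum N z + sqsum N w).
  rewrite -big_split/= mulr_sumr; apply: ler_sum => l _.
  rewrite nrmM nrmC; have := sqr_ge0 (nrm (z l) - nrm (w l)).
  move: (nrm _) (nrm _) => a b; rewrite sqrrB; nra.
move=> /le_lt_trans; apply; lra.
Qed.

(** The identity [(1 - <z, w>) K_w(z) = 1] without a quotient, which can be summed against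
    coefficients. Finite support of one of the two points makes the inner product a finite sum. *)
Lemma da_kernelE N (w z : unit_ball R) :
  fsupp N (\val z) \/ fsupp N (\val w) ->
  da_kernel w z = 1 + (\sum_(l < N) \val z l * Num.conj (\val w l)) * da_kernel w z.
Proof.
move=> zw; rewrite /da_kernel (l2_dot_fsupp zw).
have := dot_lt1 (ball_sqsum z N) (ball_sqsum w N).
set t := \sum_(_ < N) _ => t1; have t0 : 1 - t != 0.
  apply/eqP => /eqP; rewrite subr_eq0 => /eqP t1'; move: t1.
  by rewrite -t1' /nrm normr1 ltxx.
by apply/(mulfI t0); rewrite mulrDr mulrCA divff// !mulr1 subrK.
Qed.

Lemma origin_exists : exists p : unit_ball R, \val p = fun=> 0.
Proof.
by apply: (@pt_exists 0%N) => //; rewrite /sqsum big_ord0 ltr01.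
Qed.

Definition origin : unit_ball R := sval (cid origin_exists).

Lemma val_origin : \val origin = fun=> 0.
Proof. exact: svalP (cid origin_exists). Qed.

Lemma fsupp_origin : fsupp 0 (\val origin).
Proof. by move=> l _; rewrite val_origin. Qed.

Lemma da_kernel_origin (w : unit_ball R) : da_kernel w origin = 1.
Proof.
rewrite (@da_kernelE 0); first by rewrite big_ord0 mul0r addr0.
by left; exact: fsupp_origin.
Qed.

(** The point [p + t e_i]. Since [i] lies outside the support of [p], its norm does not depend on
    [i], which makes kernel bounds at these points uniform in [i]. *)
Lemma perturb_point N (p : unit_ball R) i (t : R) : fsupp N (\val p) -> (N <= i)%N ->
  0 <= t -> sqsum N (\val p) + t ^+ 2 < 1 ->
  exists p' : unit_ball R, let h := fun l => \val p' l - \val p l in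
    [/\ fsupp i.+1 (\val p'),
        forall l, \val p' l = if l == i then t%:C else \val p l,
        l2 h, l2sq h = t ^+ 2 &
        l2sq (\val p') = sqsum N (\val p) + t ^+ 2].
Proof.
move=> pN Ni t0 t1; pose v l := if l == i then t%:C else \val p l.
have vi : fsupp i.+1 v.
  by move=> l il; rewrite /v gtn_eqF// pN// (leq_trans Ni)// ltnW.
have sv : sqsum i.+1 v = sqsum N (\val p) + t ^+ 2.
  rewrite sqsumS /v eqxx nrm_real ger0_norm//; congr (_ + _).
  rewrite -(sqsum_fsupp pN Ni); apply: eq_bigr => l _.
  by rewrite /v ltn_eqF.
have [p' p'E] : exists p' : unit_ball R, \val p' = v.
  by apply: pt_exists vi _; rewrite sv.
exists p' => h; have hi : fsupp i.+1 h.
  by move=> l il; rewrite /h p'E vi// sub0r pN ?oppr0// (leq_trans Ni)// ltnW.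
have sh : sqsum i.+1 h = t ^+ 2.
  rewrite sqsumS /sqsum big1 ?add0r => [|l _].
    by rewrite /h p'E /v eqxx pN// subr0 nrm_real ger0_norm.
  by rewrite /h p'E /v ltn_eqF// subrr nrm0 expr0n.
split; rewrite ?p'E//.
- exact: l2_fsupp hi.
- by rewrite (l2sq_fsupp hi).
- by rewrite (l2sq_fsupp vi).
Qed.

End Ball.

(** * Backward shifts on the Drury-Arveson space *)

Section Shift.
Context (R : realType) (H : drury_arveson R).
Local Notation "''[' f , g ]" := (rkhs_dot H f g).
Local Notation K := (rkhs_kernel H).
Local Notation ev f w := (rkhs_fun H f w : R[i]).
Implicit Types (f g h : H) (V : set H) (p w z : unit_ball R).

Let normE := @rkhs_normE _ _ _ H.

Lemma evE f w : ev f w = '[f, K w].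
Proof. exact: rkhs_reproducing. Qed.

Lemma ev_linear (a : R[i]) f g w : ev (a *: f + g) w = a * ev f w + ev g w.
Proof. by rewrite !evE dotDl dotZl. Qed.

Lemma ev_le f w : nrm (ev f w) <= nrm f * nrm (K w).
Proof. by rewrite evE; exact: (nrm_dot_le normE). Qed.

Lemma fsupp_ev0 f : (forall p N, fsupp N (\val p) -> ev f p = 0) -> f = 0.
Proof.
move=> f0; apply: (@rkhs_fun_inj _ _ _ H); rewrite linear0; apply/funext => w.
exact: (holomorphic_fsupp0 (@da_holomorphic _ H f) f0).
Qed.

(** The component of [f] orthogonal to [V] vanishes at every point of finite support, hence is
    zero. *)
Lemma kernel_total V : linear_set V -> seq_closed V ->
  (forall p N, fsupp N (\val p) -> V (K p)) -> forall f, V f.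
Proof.
move=> VL Vc VK f; suff : f - oproj (rkhs_dot H) V f = 0.
  by move/eqP; rewrite subr_eq0 => /eqP ->; exact: (proj_in normE).
apply: fsupp_ev0 => p N pN; rewrite evE; apply: (proj_orth normE) => //; exact: VK pN.
Qed.

(** Records a finite combination [x] of kernels, the sum [c] of its coefficients (its value at the
    origin) and the family [y] of its prospective backward shifts, which multiply [K p] by the
    conjugate coordinates of [p]. It is a relation because [y] is read off the chosen combination
    and is not yet known to depend only on [x]. *)
Inductive kernel_span (N : nat) : R[i] -> H -> (nat -> H) -> Prop :=
| kernel_span0 : kernel_span N 0 0 (fun=> 0)
| kernel_spanS (a : R[i]) p c x y : fsupp N (\val p) -> kernel_span N c x y ->
    kernel_span N (a + c) (a *: K p + x)
      (fun l => (a * Num.conj (\val p l)) *: K p + y l).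

Lemma kernel_span_le N N' c x y : (N <= N')%N ->
  kernel_span N c x y -> kernel_span N' c x y.
Proof.
move=> NN'; elim=> [|a p {}c {}x {}y pN _ IH]; first exact: kernel_span0.
by apply: kernel_spanS => // l N'l; apply: pN; exact: leq_trans N'l.
Qed.

Lemma kernel_span_linear N (a : R[i]) c x y c' x' y' :
  kernel_span N c x y -> kernel_span N c' x' y' ->
  kernel_span N (a * c + c') (a *: x + x') (fun l => a *: y l + y' l).
Proof.
move=> xy xy'; elim: xy => [|b p {}c {}x {}y pN _ IH].
  rewrite mulr0 scaler0 !add0r; under eq_fun do rewrite add0r.
  exact: xy'.
have := kernel_spanS (a * b) pN IH.
rewrite mulrDr -addrA scalerDr scalerA -addrA.
by under eq_fun do rewrite -mulrA -scalerA addrA -scalerDr.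
Qed.

(* Since [(1 - <z, w>) K_w(z) = 1]. *)
Lemma kernel_span_dot N c x y c' x' y' :
  kernel_span N c x y -> kernel_span N c' x' y' ->
  '[x, x'] = c * Num.conj c' + \sum_(l < N) '[y l, y' l].
Proof.
move=> xy xy'; elim: xy => [|a p {}c {}x {}y pN _ IH].
  by rewrite dot0l mul0r add0r big1// => l _; rewrite dot0l.
rewrite dotDl IH dotZl.
have -> : '[K p, x'] = Num.conj c' + \sum_(l < N) Num.conj (\val p l) * '[K p, y' l].
  elim: xy' {IH} => [|b q {}c' {}x' {}y' qN _ IH'].
    by rewrite dot0r rmorph0 add0r big1// => l _; rewrite mulr0.
  have Kpq : '[K p, K q] =
      1 + (\sum_(l < N) \val q l * Num.conj (\val p l)) * '[K p, K q].
    by rewrite -evE rkhs_kernelE -da_kernelE//; right.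
  rewrite dotDr IH' dotZr {1}Kpq rmorphD/= mulrDr mulr1 -!addrA; congr (_ + _).
  rewrite addrCA; congr (_ + _); under [RHS]eq_bigr do rewrite dotDr mulrDr dotZr.
  rewrite big_split/=; congr (_ + _); rewrite mulr_suml mulr_sumr.
  by apply: eq_bigr => l _; rewrite rmorphM/= conjCK; ring.
under [in RHS]eq_bigr do rewrite dotDl dotZl -mulrA.
rewrite big_split/= -mulr_sumr; ring.
Qed.

(** By [kernel_span_dot], [nrm x ^+ 2] is [nrm c ^+ 2] plus the sum of all [nrm (y l) ^+ 2], once
    the support bound is raised to at least [k]. This is the contractivity of the row of shifts. *)
Lemma kernel_span_row N c x y : kernel_span N c x y ->
  forall k, \sum_(l < k) nrm (y l) ^+ 2 <= nrm x ^+ 2.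
Proof.
move=> xy k; have {}xy := kernel_span_le (leq_maxl N k) xy.
have := kernel_span_dot xy xy; rewrite (dot_nrm normE) -normCK -nrmE -rmorphXn/=.
under eq_bigr do rewrite (dot_nrm normE).
rewrite -rmorph_sum -rmorphD => /complexI ->.
rewrite -!(big_mkord xpredT (fun l => nrm (y l) ^+ 2)).
rewrite [leRHS](_ : _ = nrm c ^+ 2 + (\sum_(0 <= l < k) nrm (y l) ^+ 2 +
   \sum_(k <= l < maxn N k) nrm (y l) ^+ 2)); last first.
  by rewrite -big_cat_nat// leq_maxr.
by rewrite addrCA lerDl addr_ge0 ?sqr_ge0// sumr_ge0// => l _; rewrite sqr_ge0.
Qed.

(** The closure of [kernel_span]; the row bound makes it the graph of a contraction from [H] to
    sequences in [H]. *)
Definition bshift_graph f (u : nat -> H) := exists N c x y,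
  [/\ forall n : nat, kernel_span (N n) (c n) (x n) (y n),
      (fun n => nrm (x n - f)) @ \oo --> (0 : R)
    & forall l, (fun n => nrm (y n l - u l)) @ \oo --> (0 : R)].

Lemma bshift_graph_row f u : bshift_graph f u ->
  forall k, \sum_(l < k) nrm (u l) ^+ 2 <= nrm f ^+ 2.
Proof.
move=> [N [c [x [y [xy xf yu]]]]] k.
have cu : (fun n => \sum_(l < k) nrm (y n l) ^+ 2) @ \oo --> \sum_(l < k) nrm (u l) ^+ 2.
  by apply: (@cvg_sum_ord _ k (fun l n => nrm (y n l) ^+ 2)) => l;
    rewrite expr2; apply: cvgM; exact: (cvg_nrm_dist (yu l)).
have cf : (fun n => nrm (x n) ^+ 2) @ \oo --> nrm f ^+ 2.
  by rewrite expr2; apply: cvgM; exact: (cvg_nrm_dist xf).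
by apply: (ler_cvg_to cu cf); apply: nearW => n; exact: kernel_span_row (xy n) k.
Qed.

Lemma bshift_graph_linear (a : R[i]) f u g v : bshift_graph f u -> bshift_graph g v ->
  bshift_graph (a *: f + g) (fun l => a *: u l + v l).
Proof.
move=> [N [c [x [y [xy xf yu]]]]] [N' [c' [x' [y' [xy' xg yv]]]]].
have lim (s s' : nat -> H) h h' : (fun n => nrm (s n - h)) @ \oo --> (0 : R) ->
    (fun n => nrm (s' n - h')) @ \oo --> (0 : R) ->
    (fun n => nrm (a *: s n + s' n - (a *: h + h'))) @ \oo --> (0 : R).
  move=> sh sh'; apply: cvg0_le (cvg0D (cvg0Ml (nrm a) sh) sh') => n.
  by rewrite nrm_ge0/= -nrmZ scalerBr opprD addrACA nrmD.
exists (fun n => maxn (N n) (N' n)), (fun n => a * c n + c' n),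
  (fun n => a *: x n + x' n), (fun n l => a *: y n l + y' n l).
split=> [n||l]; [|exact: lim|exact: lim].
apply: kernel_span_linear; first exact: kernel_span_le (leq_maxl _ _) (xy n).
exact: kernel_span_le (leq_maxr _ _) (xy' n).
Qed.

(** The difference of the two families lies over the zero vector, where the row bound kills it. *)
Lemma bshift_graph_uniq f u v : bshift_graph f u -> bshift_graph f v -> u = v.
Proof.
move=> fu fv; have := bshift_graph_linear (-1) fu fv.
rewrite scaleN1r addNr => /bshift_graph_row row; apply/funext => l; apply/eqP.
rewrite eq_sym -subr_eq0; apply/eqP/nrm_eq0/eqP; rewrite -sqrf_eq0 eq_le sqr_ge0 andbT.
have := row l.+1; rewrite nrm0 expr0n/= big_ord_recr/= scaleN1r [- _ + _]addrC.
apply: le_trans.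
by rewrite lerDr sumr_ge0// => i _; rewrite sqr_ge0.
Qed.

Lemma bshift_graph_kernel p N : fsupp N (\val p) ->
  bshift_graph (K p) (fun l => Num.conj (\val p l) *: K p).
Proof.
move=> pN; have := kernel_spanS 1 pN (kernel_span0 N).
rewrite scale1r !addr0; under eq_fun do rewrite mul1r addr0.
move=> sp; exists (fun=> N), (fun=> 1), (fun=> K p),
  (fun=> fun l => Num.conj (\val p l) *: K p).
by split=> // [|l]; rewrite subrr nrm0; exact: cvg_cst.
Qed.

(** The vectors that can be approximated form a closed subspace containing the kernels, so
    [kernel_total] applies. *)
Lemma kernel_span_dense f (e : R) : 0 < e ->
  exists N c x y, kernel_span N c x y /\ nrm (x - f) < e.
Proof.
move: e; pose V := [set f : H | forall e : R, 0 < e ->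
  exists N c x y, kernel_span N c x y /\ nrm (x - f) < e].
suff : forall f, V f by exact.
apply: kernel_total.
- split=> [e e0|a g h Vg Vh e e0].
    by exists 0%N, 0, 0, (fun=> 0); rewrite subrr nrm0; split=> //; exact: kernel_span0.
  have [|N [c [x [y [xy xg]]]]] := Vg (e / (2 * (1 + nrm a))).
    by rewrite divr_gt0// mulr_gt0// ltr_pwDl// nrm_ge0.
  have [|N' [c' [x' [y' [xy' xh]]]]] := Vh (e / 2); first by rewrite divr_gt0.
  exists (maxn N N'), (a * c + c'), (a *: x + x'), (fun l => a *: y l + y' l); split.
    apply: kernel_span_linear; first exact: kernel_span_le (leq_maxl _ _) xy.
    exact: kernel_span_le (leq_maxr _ _) xy'.
  rewrite opprD addrACA -scalerBr (le_lt_trans (nrmD _ _))// nrmZ.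
  have a1 : 0 < 1 + nrm a by rewrite ltr_pwDl// nrm_ge0.
  have : (1 + nrm a) * nrm (x - g) < e / 2.
    by rewrite mulrC -ltr_pdivlMr// -mulrA -invfM.
  have := nrm_ge0 (x - g); lra.
- move=> u l Vu ul e e0; have e2 : 0 < e / 2 by rewrite divr_gt0.
  move/cvgr0Pnorm_lt : ul => /(_ _ e2)[n _ /(_ n (leqnn n)) un].
  have [N [c [x [y [xy xu]]]]] := Vu n _ e2.
  exists N, c, x, y; split=> //; rewrite (le_lt_trans (nrm_dist (u n) _ _))//.
  by have := ler_norm (nrm (u n - l)); lra.
- move=> p N pN e e0; exists N, (1 + 0), (1 *: K p + 0).
  exists (fun l => (1 * Num.conj (\val p l)) *: K p + 0); split.
    exact: kernel_spanS pN (kernel_span0 N).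
  by rewrite scale1r addr0 subrr nrm0.
Qed.

(** Approximate [f] by combinations of kernels; the row bound applied to their differences makes
    each sequence of shifts Cauchy. *)
Lemma bshift_graph_total f : exists u, bshift_graph f u.
Proof.
have inv0 n : 0 < (n.+1%:R^-1 : R) by rewrite invr_gt0.
have /choice[s sP] n : exists s : nat * R[i] * H * (nat -> H),
    let: (N, c, x, y) := s in kernel_span N c x y /\ nrm (x - f) < n.+1%:R^-1.
  by have [N [c [x [y xy]]]] := kernel_span_dense f (inv0 n); exists (N, c, x, y).
pose N n := (s n).1.1.1; pose c n := (s n).1.1.2; pose x n := (s n).1.2.
pose y n := (s n).2.
have xy n : kernel_span (N n) (c n) (x n) (y n).
  by have := sP n; rewrite /N /c /x /y; case: (s n) => [[[? ?] ?] ?] [].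
have xf n : nrm (x n - f) < n.+1%:R^-1.
  by have := sP n; rewrite /x; case: (s n) => [[[? ?] ?] ?] [].
have lip m n l : nrm (y m l - y n l) <= nrm (x m - x n).
  have : kernel_span (maxn (N m) (N n)) (-1 * c n + c m) (-1 *: x n + x m)
      (fun l => -1 *: y n l + y m l).
    by apply: kernel_span_linear; [exact: kernel_span_le (leq_maxr _ _) (xy n)|
      exact: kernel_span_le (leq_maxl _ _) (xy m)].
  move/kernel_span_row => /(_ l.+1); rewrite big_ord_recr/= !scaleN1r ![- _ + _]addrC.
  move=> row; rewrite -(@ler_pXn2r _ 2%N) ?nnegrE ?nrm_ge0//; apply: le_trans row.
  by rewrite lerDr sumr_ge0// => i _; rewrite sqr_ge0.
have xf0 : (fun n => nrm (x n - f)) @ \oo --> (0 : R).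
  apply: cvg0_le (cvg_harmonic) => n; rewrite nrm_ge0/=; exact: ltW.
have /choice[u uP] l : exists v, (fun n => nrm (y n l - v)) @ \oo --> (0 : R).
  apply: nrm_complete => e e0; have e2 : 0 < e / 2 by rewrite divr_gt0.
  move/cvgr0Pnorm_lt : xf0 => /(_ _ e2)[M _ HM]; exists M => m n Mm Mn.
  rewrite (le_trans (lip m n l))// (le_trans (nrm_dist f _ _))// (nrm_distC f).
  have := HM _ Mm; have := HM _ Mn; rewrite !ger0_norm ?nrm_ge0//.
  by move: (nrm _) (nrm _) => A B; lra.
by exists u, N, c, x, y.
Qed.

(** The adjoint of multiplication by [z_l], as [bshift_adjoint] shows. The construction by closure
    does not presuppose that [z_l f] belongs to [H] for every [f]. *)
Definition bshift l f : H := sval (cid (bshift_graph_total f)) l.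

Lemma bshiftP f : bshift_graph f (bshift^~ f).
Proof. exact: (svalP (cid (bshift_graph_total f))). Qed.

Lemma bshift_linear l (a : R[i]) f g :
  bshift l (a *: f + g) = a *: bshift l f + bshift l g.
Proof.
have := bshift_graph_uniq (bshiftP _) (bshift_graph_linear a (bshiftP f) (bshiftP g)).
by move=> /(congr1 (@^~ l)).
Qed.

Lemma bshift_kernel l p N : fsupp N (\val p) ->
  bshift l (K p) = Num.conj (\val p l) *: K p.
Proof.
move=> pN; have := bshift_graph_uniq (bshiftP _) (bshift_graph_kernel pN).
by move=> /(congr1 (@^~ l)).
Qed.

Lemma bshift_row k f : \sum_(l < k) nrm (bshift l f) ^+ 2 <= nrm f ^+ 2.
Proof. exact: bshift_graph_row (bshiftP f) k. Qed.

End Shift.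

(** * Commutation, adjointness and point evaluation of the backward shifts *)

Section ShiftTheory.
Context (R : realType) (H : drury_arveson R).
Local Notation "''[' f , g ]" := (rkhs_dot H f g).
Local Notation K := (rkhs_kernel H).
Local Notation ev f w := (rkhs_fun H f w : R[i]).
Local Notation origin := (origin R).
Implicit Types (f g h : H) (V : set H) (p w z : unit_ball R).

Let normE := @rkhs_normE _ _ _ H.

Lemma bshift0 l : bshift l (0 : H) = 0.
Proof.
have := bshift_linear l 1 (0 : H) 0; rewrite !scale1r addr0 => /eqP.
by rewrite -subr_eq0 opprD addNKr oppr_eq0 => /eqP.
Qed.

Lemma bshiftD l f g : bshift l (f + g) = bshift l f + bshift l g.
Proof. by have := bshift_linear l 1 f g; rewrite !scale1r. Qed.

Lemma bshiftZ l (a : R[i]) f : bshift l (a *: f) = a *: bshift l f.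
Proof. by have := bshift_linear l a f 0; rewrite bshift0 !addr0. Qed.

Lemma bshiftB l f g : bshift l (f - g) = bshift l f - bshift l g.
Proof. by rewrite -scaleN1r bshiftD bshiftZ scaleN1r. Qed.

Lemma bshift_sum l I (s : seq I) (P : pred I) (F : I -> H) :
  bshift l (\sum_(i <- s | P i) F i) = \sum_(i <- s | P i) bshift l (F i).
Proof. exact: (big_morph _ (bshiftD l) (bshift0 l)). Qed.

Lemma bshift_le l f : nrm (bshift l f) <= nrm f.
Proof.
rewrite -(@ler_pXn2r _ 2%N) ?nnegrE ?nrm_ge0//.
apply: le_trans (bshift_row l.+1 f); rewrite big_ord_recr/= lerDr.
by rewrite sumr_ge0// => i _; rewrite sqr_ge0.
Qed.

Lemma bshift_le2 l m f : l != m ->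
  nrm (bshift l f) ^+ 2 + nrm (bshift m f) ^+ 2 <= nrm f ^+ 2.
Proof.
move=> lm; apply: le_trans (bshift_row (maxn l m).+1 f).
have lN : (l < (maxn l m).+1)%N by rewrite ltnS leq_maxl.
have mN : (m < (maxn l m).+1)%N by rewrite ltnS leq_maxr.
rewrite (bigD1 (Ordinal lN))//= (bigD1 (Ordinal mN))/=; last first.
  by rewrite -val_eqE/= eq_sym.
by rewrite addrA lerDl sumr_ge0// => i _; rewrite sqr_ge0.
Qed.

(** The squares of these norms are summable by the row bound. By adjointness this makes the sequence
    [z_i e] weakly null. *)
Lemma bshift_cvg0 f : (fun l => nrm (bshift l f)) @ \oo --> (0 : R).
Proof.
apply: cvg0_sqr => [l|]; first exact: nrm_ge0.
apply: cvg_series_cvg_0; apply: nondecreasing_is_cvgn.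
  by apply/nondecreasing_seqP => n; rewrite /series/= big_nat_recr//= lerDl sqr_ge0.
by exists (nrm f ^+ 2) => _ [n _ <-]; rewrite /series/= big_mkord bshift_row.
Qed.

(** The zero set of a bounded functional is a closed subspace, so identities between such
    functionals need only be checked on kernels. *)
Lemma kernel_ext (phi : H -> R[i]) (C : R) :
  (forall (a : R[i]) f g, phi (a *: f + g) = a * phi f + phi g) ->
  (forall f, nrm (phi f) <= C * nrm f) ->
  (forall p N, fsupp N (\val p) -> phi (K p) = 0) -> forall f, phi f = 0.
Proof.
move=> lin bnd phiK; apply: (@kernel_total _ _ [set f | phi f = 0]) => //=.
  split=> [|a f g /= f0 g0]; last by rewrite lin f0 g0 mulr0 addr0.
  by apply: nrm_eq0; apply/eqP; rewrite eq_le nrm_ge0 andbT (le_trans (bnd _))//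
    nrm0 mulr0.
move=> u l /= u0 ul; apply: nrm_eq0; apply/eqP; rewrite eq_le nrm_ge0 andbT.
apply: cvg_ge_cst (cvg0Ml C ul) _ => n; apply: le_trans (bnd _).
have phiB : phi (u n - l) = - phi l.
  have := lin (-1) l (u n); rewrite scaleN1r addrC mulN1r (_ : phi (u n) = 0)//.
  by rewrite addr0.
by rewrite phiB nrmN.
Qed.

Lemma bshiftC l m f : bshift l (bshift m f) = bshift m (bshift l f).
Proof.
suff dot0 q : '[bshift l (bshift m f) - bshift m (bshift l f), q] = 0.
  by apply/eqP; rewrite -subr_eq0; apply/eqP/(dotff_eq0 normE)/dot0.
apply: (@kernel_ext (fun f => '[bshift l (bshift m f) - bshift m (bshift l f), q])
  (2 * nrm q)) => {f} [a f g|f|p N pN].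
- by rewrite !bshift_linear opprD addrACA -scalerBr [LHS]dotDl dotZl.
- rewrite (le_trans (nrm_dot_le normE _ _))// mulrAC ler_wpM2r ?nrm_ge0//.
  rewrite (le_trans (nrmB _ _))// mulr_natl mulr2n lerD//.
    by rewrite (le_trans (bshift_le _ _))// bshift_le.
  by rewrite (le_trans (bshift_le _ _))// bshift_le.
- rewrite !(bshift_kernel _ _ pN) !bshiftZ !(bshift_kernel _ _ pN) !scalerA.
  by rewrite [_ * Num.conj _]mulrC subrr dot0l.
Qed.

Lemma bshift_adjoint l f h : is_coord_mul l f h -> forall g, '[h, g] = '[f, bshift l g].
Proof.
move=> hE g; suff : '[bshift l g, f] - '[g, h] = 0.
  by move/eqP; rewrite subr_eq0 => /eqP e; rewrite dotC -e -dotC.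
apply: (@kernel_ext (fun g => '[bshift l g, f] - '[g, h]) (nrm f + nrm h))
  => {g} [a f' g'|g|p N pN].
- by rewrite bshift_linear !dotDl !dotZl; ring.
- rewrite (le_trans (nrmB _ _))// mulrDl lerD// (le_trans (nrm_dot_le normE _ _))//.
    by rewrite mulrC ler_wpM2l ?nrm_ge0// bshift_le.
  by rewrite mulrC.
- rewrite (bshift_kernel _ _ pN) dotZl ['[K p, f]]dotC ['[K p, h]]dotC -!evE hE.
  by rewrite rmorphM/= subrr.
Qed.

(** Both sides are bounded functionals of [f], and for a kernel the identity is [da_kernelE]. The
    backward shifts thus solve Gleason's problem at the origin. *)
Lemma bshift_expand N p f : fsupp N (\val p) ->
  ev f p = ev f origin + \sum_(l < N) \val p l * ev (bshift l f) p.
Proof.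
move=> pN; apply/eqP; rewrite -subr_eq0; apply/eqP.
pose phi f := ev f p - (ev f origin + \sum_(l < N) \val p l * ev (bshift l f) p).
apply: (@kernel_ext phi (nrm (K p) +
    (nrm (K origin) + \sum_(l < N) nrm (\val p l) * nrm (K p)))) =>
  {f} [a f g|f|w n wn]; rewrite /phi.
- rewrite !ev_linear; under eq_bigr do rewrite bshift_linear ev_linear mulrDr mulrCA.
  by rewrite big_split/= -mulr_sumr; ring.
- rewrite (le_trans (nrmB _ _))// mulrDl lerD//; first by rewrite mulrC ev_le.
  rewrite (le_trans (nrmD _ _))// mulrDl lerD//; first by rewrite mulrC ev_le.
  rewrite (le_trans (nrm_sum _ _ _))// mulr_suml ler_sum// => l _.
  rewrite nrmM -mulrA ler_wpM2l ?nrm_ge0// (le_trans (ev_le _ _))// mulrC.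
  by rewrite ler_wpM2l ?nrm_ge0// bshift_le.
- under eq_bigr do
    rewrite (bshift_kernel _ _ wn) -[_ *: _]addr0 ev_linear linear0 addr0 mulrA.
  rewrite -mulr_suml !rkhs_kernelE da_kernel_origin {1}(@da_kernelE _ N); last by left.
  by rewrite subrr.
Qed.

(** With this operator [bshift_expand] can be iterated: the value at the origin of its [j]-th
    iterate on [f] is the homogeneous part of degree [j] of [f], evaluated at [p]. *)
Definition point_shift N p f : H := \sum_(l < N) \val p l *: bshift l f.

Lemma point_shift_ev N p f : fsupp N (\val p) ->
  ev f p = ev f origin + ev (point_shift N p f) p.
Proof.
move=> pN; rewrite (bshift_expand f pN) [ev (point_shift _ _ _) _]evE dot_suml.
by congr (_ + _); apply: eq_bigr => l _; rewrite dotZl evE.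
Qed.

(** The inequality [2ab <= a^2 + b^2] with [a = |f| |p_l|] and [b = |B_l f|], summed using the row
    bound and divided by [2 |f|]. The constant is below [1] on the ball, so the iterates decay
    geometrically. *)
Lemma point_shift_le N p f :
  nrm (point_shift N p f) <= (1 + sqsum N (\val p)) / 2 * nrm f.
Proof.
have [/nrm_eq0 ->|f0] := eqVneq (nrm f) 0.
  rewrite /point_shift big1 ?nrm0 ?mulr0// => l _; by rewrite bshift0 scaler0.
have fgt0 : 0 < nrm f by rewrite lt_def f0 nrm_ge0.
apply: le_trans (nrm_sum _ _ _) _.
have : 2 * nrm f * \sum_(l < N) nrm (\val p l *: bshift l f) <=
    nrm f ^+ 2 * sqsum N (\val p) + \sum_(l < N) nrm (bshift l f) ^+ 2.
  rewrite !mulr_sumr -big_split/=; apply: ler_sum => l _; rewrite nrmZ.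
  have := sqr_ge0 (nrm f * nrm (\val p l) - nrm (bshift l f)).
  by move: (nrm _) (nrm _) (nrm _) => a b c; nra.
have := bshift_row N f => rowN h.
rewrite -(@ler_pM2l _ (2 * nrm f)) ?mulr_gt0//.
apply: le_trans h _.
have -> : 2 * nrm f * ((1 + sqsum N (\val p)) / 2 * nrm f) =
  nrm f ^+ 2 * sqsum N (\val p) + nrm f ^+ 2 by field.
by rewrite lerD2l.
Qed.

Lemma bshift_point_shift N p l f :
  bshift l (point_shift N p f) = point_shift N p (bshift l f).
Proof. by rewrite bshift_sum; apply: eq_bigr => m _; rewrite bshiftZ bshiftC. Qed.

Lemma iter_bshift_point_shift N p l k f :
  bshift l (iter k (point_shift N p) f) = iter k (point_shift N p) (bshift l f).
Proof. by elim: k => //= k IH; rewrite bshift_point_shift IH. Qed.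

Lemma iter_point_shift_ev N p k f : fsupp N (\val p) ->
  ev f p = \sum_(j < k) ev (iter j (point_shift N p) f) origin +
           ev (iter k (point_shift N p) f) p.
Proof.
move=> pN; elim: k => [|k ->]; first by rewrite big_ord0 add0r.
by rewrite big_ord_recr/= -addrA -point_shift_ev.
Qed.

Lemma iter_point_shift_le N p k f :
  nrm (iter k (point_shift N p) f) <= ((1 + sqsum N (\val p)) / 2) ^+ k * nrm f.
Proof.
elim: k => [|k IH]; first by rewrite mul1r.
rewrite iterS (le_trans (point_shift_le _ _ _))// exprS -[leRHS]mulrA ler_wpM2l//.
by rewrite divr_ge0// addr_ge0// sqsum_ge0.
Qed.

Lemma nrm_kernel w : nrm (K w) ^+ 2 = (1 - l2sq (\val w))^-1 :> R.
Proof.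
apply: complexI; rewrite -(dot_nrm normE) -evE rkhs_kernelE /da_kernel.
have /set_mem/ballP[lw _] := valP w; rewrite (sqsum_cvg lw).2.
by rewrite fmorphV rmorphB rmorph1.
Qed.

End ShiftTheory.

(** * Submodules of finite rank *)

Section Submodule.
Context (R : realType) (H : drury_arveson R) (M : set H) (subM : submodule M).
Local Notation "''[' f , g ]" := (rkhs_dot H f g).
Local Notation K := (rkhs_kernel H).
Local Notation ev f w := (rkhs_fun H f w : R[i]).
Local Notation origin := (origin R).
Implicit Types (f g h q e : H) (p w z : unit_ball R) (x : nat -> H).

Let normE := @rkhs_normE _ _ _ H.

Local Notation P f := (oproj (rkhs_dot H) M f).
Local Notation Q f := (f - P f).

Lemma submodule_linear : linear_set M.
Proof. by case: subM => -[_ M0 ML] _; split. Qed.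

Lemma submodule_closed : seq_closed M.
Proof. by case: subM => -[cM _ _] _ u l Mu; exact: closed_nrm. Qed.

Let ML := submodule_linear.
Let Mc := submodule_closed.

Lemma coord_mulP i f : M f -> M (coord_mul i f) /\ is_coord_mul i f (coord_mul i f).
Proof.
move=> Mf; have [h Mh hE] := subM.2 i f Mf.
have cE : is_coord_mul i f (coord_mul i f) by apply: xgetPex; exists h.
suff -> : coord_mul i f = h by [].
apply: (@rkhs_fun_inj _ _ _ H); apply/funext => z; by rewrite cE hE.
Qed.

Lemma coord_mul_in i f : M f -> M (coord_mul i f).
Proof. by case/(coord_mulP i). Qed.

Lemma coord_mul_dotl i f g : M f -> '[coord_mul i f, g] = '[f, bshift i g].
Proof. by move=> Mf; apply: bshift_adjoint; case: (coord_mulP i Mf). Qed.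

Lemma coord_mul_dotr i f g : M f -> '[g, coord_mul i f] = '[bshift i g, f].
Proof. by move=> Mf; rewrite dotC coord_mul_dotl// -dotC. Qed.

Lemma coord_mul_ev i f w : M f -> ev (coord_mul i f) w = \val w i * ev f w.
Proof. by move=> Mf; case: (coord_mulP i Mf) => _ ->. Qed.

Lemma nrm_coord_mul i f : M f -> nrm (coord_mul i f) <= nrm f.
Proof.
move=> Mf; have [/eqP|X0] := eqVneq (nrm (coord_mul i f)) 0.
  by move=> /eqP ->; exact: nrm_ge0.
have Xgt0 : 0 < nrm (coord_mul i f) by rewrite lt_def X0 nrm_ge0.
rewrite -(ler_pM2r Xgt0) -expr2 -(nrm_dotff normE) coord_mul_dotl//.
by rewrite (le_trans (nrm_dot_le normE _ _))// ler_wpM2l ?nrm_ge0// bshift_le.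
Qed.

Lemma adjoint_coord_mul i g : adjoint M (coord_mul i) g = P (bshift i g).
Proof.
apply: xget_unique.
  split; first exact: (proj_in normE).
  by move=> f Mf; rewrite coord_mul_dotl// dotC -(proj_dotl normE ML Mc _ Mf) -dotC.
move=> h [Mh hE]; apply/esym/(proj_uniq normE ML Mc) => // f Mf.
by rewrite dotBl [X in X - _]dotC -coord_mul_dotl// hE// -dotC subrr.
Qed.

Lemma proj_self f g : '[P f, g] = '[f, P g].
Proof.
have PP := proj_in normE ML Mc.
by rewrite -(proj_dotl normE ML Mc f (PP g)) dotC -(proj_dotl normE ML Mc g (PP f)) -dotC.
Qed.

Lemma bshift_orth l u : (forall g, M g -> '[u, g] = 0) ->
  forall g, M g -> '[bshift l u, g] = 0.
Proof. by move=> uM g Mg; rewrite -coord_mul_dotr// uM//; exact: coord_mul_in. Qed.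

(** By [bshift_orth] the backward shift of [Q f] stays orthogonal to [M] and contributes nothing. *)
Lemma proj_bshift l f : P (bshift l f) = P (bshift l (P f)).
Proof.
have := proj_linear normE ML Mc (-1) (bshift l (P f)) (bshift l f).
rewrite !scaleN1r ![- _ + _]addrC -bshiftB (proj_eq0 normE ML Mc) => [/eqP|].
  by rewrite eq_sym subr_eq0 => /eqP.
by apply: bshift_orth => g; exact: (proj_orth normE).
Qed.

Lemma coproj_linear (a : R[i]) f g : Q (a *: f + g) = a *: Q f + Q g.
Proof. by rewrite (proj_linear normE ML Mc) opprD addrACA -scalerBr. Qed.

Lemma coproj0 : Q 0 = 0.
Proof. by rewrite (proj_id normE ML Mc) ?subrr//; case: ML. Qed.

Lemma coprojD f g : Q (f + g) = Q f + Q g.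
Proof. by have := coproj_linear 1 f g; rewrite !scale1r. Qed.

(** The first condition lets the finite-rank defect annihilate the sequence in the limit, the second
    is the error in [defect_bound]; the pair is stable under [point_shift]. *)
Definition almost_in x :=
  (forall q, M q -> (fun i => nrm '[x i, q]) @ \oo --> (0 : R)) /\
  (fun i => nrm (Q (x i))) @ \oo --> (0 : R).

(** * The defect inequality *)

Section Defect.
Context (D S : H -> H) (n : nat).
Hypothesis DS : is_sot_lim M
  (fun k f => \sum_(i < k) coord_mul i (adjoint M (coord_mul i) f)) S.
Hypothesis Dpos : positive_operator M D.
Hypothesis D2 : forall f, M f -> D (D f) = f - S f.
Hypothesis Ddim : has_dim (D @` M) n.

Lemma defect_self_adjoint f g : M f -> M g -> '[D f, g] = '[f, D g].
Proof.
by case: Dpos => -[_ DL _] D0; exact: (self_adjoint ML DL D0).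
Qed.

(** Self-adjointness gives [|D f|^2 = <D (D f), f> = |f|^2 - <S f, f>], and the partial sums of
    [<S f, f>] are the sums of [|P B_l f|^2]. *)
Lemma defect_sum f : M f ->
  (fun k => \sum_(l < k) nrm (P (bshift l f)) ^+ 2) @ \oo -->
  nrm f ^+ 2 - nrm (D f) ^+ 2.
Proof.
move=> Mf; have MD : M (D f) by case: Dpos => -[MD _ _] _; exact: MD.
have -> : nrm f ^+ 2 - nrm (D f) ^+ 2 = complex.Re '[S f, f].
  rewrite !(nrm_sqr normE) -defect_self_adjoint// D2// dotBl !raddfB/=.
  by rewrite opprK addrA subrr add0r.
have /nrm_cvg lim := DS Mf.
apply: (@cvg_dist_le _ _ (fun k => nrm f *
    nrm (\sum_(i < k) coord_mul i (adjoint M (coord_mul i) f) - S f)));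
  last exact: cvg0Ml lim.
move=> k.
have -> : \sum_(l < k) nrm (P (bshift l f)) ^+ 2 =
    complex.Re '[\sum_(i < k) coord_mul i (adjoint M (coord_mul i) f), f].
  rewrite dot_suml raddf_sum; apply: eq_bigr => l _.
  have PB := proj_in normE ML Mc (bshift l f).
  rewrite adjoint_coord_mul coord_mul_dotl// (nrm_sqr normE).
  by rewrite -proj_self (proj_id normE ML Mc PB).
rewrite -raddfB -dotBl (le_trans (nrm_Re _))// mulrC.
exact: nrm_dot_le.
Qed.

(** Pythagoras in the row bound gives [|Q B_l f|^2 <= |f|^2 - sum_(i < k) |P B_i f|^2] for [k > l].
    Since [P B_i f = P B_i P f], the right side tends to [|f|^2 - |P f|^2 + |D P f|^2] by
    [defect_sum]. *)
Lemma defect_bound l f :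
  nrm (Q (bshift l f)) ^+ 2 <= nrm (Q f) ^+ 2 + nrm (D (P f)) ^+ 2.
Proof.
have PP := proj_in normE ML Mc.
have lim : (fun k => nrm f ^+ 2 - \sum_(i < k) nrm (P (bshift i (P f))) ^+ 2) @ \oo -->
    nrm f ^+ 2 - (nrm (P f) ^+ 2 - nrm (D (P f)) ^+ 2).
  by apply: cvgB; [exact: cvg_cst|exact: defect_sum].
rewrite [leRHS](_ : _ = nrm f ^+ 2 - (nrm (P f) ^+ 2 - nrm (D (P f)) ^+ 2)); last first.
  by rewrite [in RHS](nrm_proj normE ML Mc f); ring.
apply: (ler_cvg_to (cvg_cst _) lim); exists l.+1 => // k /= lk.
rewrite lerBrDr; apply: le_trans (bshift_row k f).
under [leRHS]eq_bigr do rewrite (nrm_proj normE ML Mc).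
rewrite big_split/= addrC; under eq_bigr do rewrite -proj_bshift.
rewrite lerD2r (bigD1 (Ordinal lk))//= lerDl sumr_ge0// => i _.
exact: sqr_ge0.
Qed.

Lemma defect_null x : almost_in x -> (fun i => nrm (D (P (x i)))) @ \oo --> (0 : R).
Proof.
case: Ddim => e [e_free DM] [xq _]; case: Dpos => -[MD _ _] _.
apply: (finite_rank_null normE MD defect_self_adjoint e_free DM) => [i|q Mq].
  exact: (proj_in normE).
apply: cvg0_le (xq _ Mq) => i; rewrite nrm_ge0/=.
by rewrite (proj_dotl normE ML Mc).
Qed.

(** The bound of [defect_bound] does not involve the index of the shift, so that index may vary with
    [i]. *)
Lemma coproj_bshift_null x (l : nat -> nat) : almost_in x ->
  (fun i => nrm (Q (bshift (l i) (x i)))) @ \oo --> (0 : R).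
Proof.
move=> ax; apply: cvg0_le (cvg0D ax.2 (defect_null ax)) => i.
rewrite nrm_ge0/= -(@ler_pXn2r _ 2%N) ?nnegrE ?addr_ge0 ?nrm_ge0//.
apply: le_trans (defect_bound _ _) _; rewrite sqrrD lerD2r lerDl.
by rewrite mulrn_wge0// mulr_ge0// nrm_ge0.
Qed.

End Defect.

(** Weak nullity is [<z_i e, q> = <e, B_i q>] together with [bshift_cvg0]; the sequence lies in [M]
    itself. *)
Lemma almost_in_coord_mul e : M e -> almost_in (fun i => coord_mul i e).
Proof.
move=> Me; split=> [q Mq|].
  apply: cvg0_le (cvg0Ml (nrm e) (bshift_cvg0 q)) => i.
  by rewrite nrm_ge0/= coord_mul_dotl// (nrm_dot_le normE).
have Q0 i : nrm (Q (coord_mul i e)) = 0.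
  by rewrite (proj_id normE ML Mc) ?subrr ?nrm0//; exact: coord_mul_in.
by under eq_fun do rewrite Q0; exact: cvg_cst.
Qed.

(** * Asymptotic invariance and the constants *)

Section AlmostInvariant.
Hypothesis coproj_null : forall x (l : nat -> nat), almost_in x ->
  (fun i => nrm (Q (bshift (l i) (x i)))) @ \oo --> (0 : R).

(** Weak nullity passes on because [B_l] moves to the other side as multiplication by [z_l], which
    preserves [M]; the other condition is [coproj_null] with constant indices. *)
Lemma almost_in_point_shift N p x : almost_in x ->
  almost_in (fun i => point_shift N p (x i)).
Proof.
move=> ax; split=> [q Mq|].
  apply: (@cvg0_le _ _ (fun i =>
      \sum_(l < N) nrm (\val p l) * nrm '[x i, coord_mul l q])).
    move=> i; rewrite nrm_ge0/= dot_suml (le_trans (nrm_sum _ _ _))//.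
    by apply: ler_sum => l _; rewrite dotZl nrmM coord_mul_dotr.
  apply: cvg0_sum => l; apply: cvg0Ml; apply: ax.1; exact: coord_mul_in.
apply: (@cvg0_le _ _ (fun i => \sum_(l < N) nrm (\val p l) * nrm (Q (bshift l (x i))))).
  move=> i; rewrite nrm_ge0/=.
  have -> : Q (point_shift N p (x i)) = \sum_(l < N) \val p l *: Q (bshift l (x i)).
    rewrite (big_morph (fun f => Q f) coprojD coproj0); apply: eq_bigr => l _.
    by have := coproj_linear (\val p l) (bshift l (x i)) 0; rewrite coproj0 !addr0.
  rewrite (le_trans (nrm_sum _ _ _))//; apply: ler_sum => l _.
  by rewrite nrmZ.
by apply: cvg0_sum => l; apply: cvg0Ml; exact: coproj_null.
Qed.

Lemma almost_in_iter N p k x : almost_in x ->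
  almost_in (fun i => iter k (point_shift N p) (x i)).
Proof. by move=> ax; elim: k => //= k; exact: almost_in_point_shift. Qed.


Lemma dot_origin y : P (K origin) = 0 -> ev y origin = '[Q y, K origin].
Proof.
by move=> K0; rewrite evE dotBl proj_self K0 dot0r subr0.
Qed.

(* By reproduction, [|z_i e|^2 = <B_i z_i e, e>] for [e] the projection of [K p]. *)
Lemma coord_mul_proj_kernel p i (e := P (K p)) (X := coord_mul i e) :
  (nrm X ^+ 2)%:C = ev (bshift i X) p - '[Q (bshift i X), K p].
Proof.
have Me : M e by exact: (proj_in normE).
rewrite evE -dotBl opprB addrC subrK -(dot_nrm normE) proj_self.
by rewrite [RHS]dotC -coord_mul_dotl// -dotC.
Qed.

Lemma proj_origin_neq0 : M <> [set 0] -> P (K origin) <> 0.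
Proof.
move=> M0 Ko0; apply: M0; apply/seteqP; split=> f /=; last by move=> ->; case: ML.
move=> Mf; apply: fsupp_ev0 => p N pN.
pose e := P (K p); have Me : M e by exact: (proj_in normE).
suff e0 : e = 0 by rewrite evE -(proj_id normE ML Mc Mf) proj_self -/e e0 dot0r.
have evep : ev e p = (nrm e ^+ 2)%:C.
  by rewrite evE -(dot_nrm normE) -[in LHS](proj_id normE ML Mc Me) proj_self.
pose X i := coord_mul i e; have aX : almost_in X by exact: almost_in_coord_mul.
pose rho := (1 + sqsum N (\val p)) / 2.
have rho0 : 0 <= rho by rewrite divr_ge0// addr_ge0// sqsum_ge0.
have rho1 : rho < 1 by have := ball_sqsum p N; rewrite /rho; lra.
(* Expand at [p] in [k] values at the origin plus a remainder of order [rho ^+ k]. As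
   [P (K origin) = 0], [dot_origin] bounds each value by [Q (x j i)], which is null because [B_i]
   commutes with the iterates. *)
have evx0 : (fun i => nrm (ev (bshift i (X i)) p)) @ \oo --> (0 : R).
  pose x j i := bshift i (iter j (point_shift N p) (X i)).
  apply: (@cvg0_approx _ _ (fun k i => \sum_(j < k) nrm (K origin) * nrm (Q (x j i)))
    (fun k => nrm e * nrm (K p) * rho ^+ k)) => [i|k i|k|].
  - exact: nrm_ge0.
  - rewrite (iter_point_shift_ev k _ pN) (le_trans (nrmD _ _))// lerD//.
      rewrite (le_trans (nrm_sum _ _ _))//; apply: ler_sum => j _.
      rewrite -iter_bshift_point_shift dot_origin// mulrC.
      exact: (nrm_dot_le normE).
    rewrite (le_trans (ev_le _ _))// mulrAC ler_wpM2r ?nrm_ge0//.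
    rewrite (le_trans (iter_point_shift_le _ _ _ _))// mulrC ler_wpM2r ?exprn_ge0//.
    by rewrite (le_trans (bshift_le _ _))// nrm_coord_mul.
  - apply: cvg0_sum => j; apply: cvg0Ml; apply: (coproj_null id).
    exact: almost_in_iter.
  - by apply: cvg0Ml; apply: cvg_expr; rewrite ger0_norm.
have X0 : (fun i => nrm (X i)) @ \oo --> (0 : R).
  apply: cvg0_sqr => [i|]; first exact: nrm_ge0.
  have QX0 : (fun i => nrm (Q (bshift i (X i)))) @ \oo --> (0 : R).
    exact: (coproj_null id).
  apply: cvg0_le (cvg0D evx0 (cvg0Ml (nrm (K p)) QX0)) => i; rewrite sqr_ge0/=.
  rewrite -[leLHS]ger0_norm ?sqr_ge0// -nrm_real coord_mul_proj_kernel.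
  by rewrite (le_trans (nrmB _ _))// lerD2l mulrC; exact: (nrm_dot_le normE).
have [C [d [C0 d0 lip]]] := holomorphic_lipschitz p (@da_holomorphic _ H e).
have S1 := ball_sqsum p N; have S0 := sqsum_ge0 N (\val p).
suff : nrm (ev e p) <= 0.
  rewrite evep nrm_real ger0_norm ?sqr_ge0// => e0; apply: nrm_eq0; apply/eqP.
  by rewrite -sqrf_eq0 eq_le e0 sqr_ge0.
(* At [p' = p + t e_i], the value of [z_i e] is [t e(p')], and it is small because [X i] is. For
   fixed [t], [i] tends to infinity and leaves [|e(p)| <= C t]; then [t] tends to zero. *)
apply: (@le0_of_small _ _ C (Num.min d (1 - sqsum N (\val p)))).
  by rewrite lt_min d0 subr_gt0.
move=> t /andP[t0]; rewrite lt_min => /andP[td tS].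
have St : sqsum N (\val p) + t ^+ 2 < 1 by nra.
(* The norm of [K p'], the same for all [i]. *)
pose k := Num.sqrt (1 - (sqsum N (\val p) + t ^+ 2))^-1.
have lim : (fun i => k / t * nrm (X i) + C * t) @ \oo --> 0 + C * t.
  by apply: cvgD; [exact: cvg0Ml|exact: cvg_cst].
rewrite -[leRHS]add0r; apply: (ler_cvg_to (cvg_cst _) lim); exists N => // i /= Ni.
have [p' [p'i p't lh h2 p'2]] := perturb_point pN Ni (ltW t0) St.
have := lip p' lh; rewrite h2 sqrtr_sqr ger0_norm ?(ltW t0)// => /(_ td) lip'.
have kE : nrm (K p') = k.
  by rewrite -[LHS]ger0_norm ?nrm_ge0// -sqrtr_sqr nrm_kernel p'2.
have := ev_le (X i) p'; rewrite coord_mul_ev// p't eqxx nrmM nrm_real kE.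
rewrite ger0_norm ?(ltW t0)// => ev_p'.
have : nrm (ev e p') <= k / t * nrm (X i).
  by rewrite mulrAC ler_pdivlMr// mulrC (mulrC k).
have := nrmD (ev e p - ev e p') (ev e p'); rewrite subrK nrm_distC.
move=> h1 h3; apply: le_trans h1 _; rewrite addrC; exact: lerD.
Qed.

(** Expanding [z_i e] at [t e_i], where it has only one nonzero term, and cancelling [t] shows that
    [e] and [B_i z_i e] agree there. Then [t] tends to zero. *)
Lemma bshift_coord_mul_origin e i : M e ->
  ev (bshift i (coord_mul i e)) origin = ev e origin.
Proof.
move=> Me; set X := coord_mul i e; pose g : H := -1 *: bshift i X + e.
have evg w : ev g w = ev e w - ev (bshift i X) w.
  by rewrite ev_linear mulN1r addrC.
suff : nrm (ev g origin) <= 0.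
  move=> g0; apply/esym/eqP; rewrite -subr_eq0 -evg; apply/eqP/nrm_eq0/eqP.
  by rewrite eq_le g0 nrm_ge0.
have [C [d [C0 d0 lip]]] := holomorphic_lipschitz origin (@da_holomorphic _ H g).
apply: (@le0_of_small _ _ C (Num.min d 1)); first by rewrite lt_min d0 ltr01.
move=> t /andP[t0]; rewrite lt_min => /andP[td t1].
have St : sqsum 0 (\val origin) + t ^+ 2 < 1.
  by rewrite /sqsum big_ord0 add0r exprn_ilt1// ltW.
have [p' [p'i p'E lh h2 _]] := perturb_point (@fsupp_origin R) (leq0n i) (ltW t0) St.
have := lip p' lh; rewrite h2 sqrtr_sqr ger0_norm ?(ltW t0)// => /(_ td).
suff -> : ev g p' = 0 by rewrite sub0r nrmN.
have : \val p' i * ev e p' = \val p' i * ev (bshift i X) p'.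
  rewrite -coord_mul_ev// (bshift_expand _ p'i) coord_mul_ev// val_origin mul0r add0r.
  rewrite big_ord_recr/= big1 ?add0r// => l _.
  by rewrite p'E ltn_eqF// val_origin mul0r.
rewrite p'E eqxx evg => /mulfI -> //; first by rewrite subrr.
by rewrite gt_eqF// ltcR.
Qed.

Lemma proj_origin_cst : exists c : R[i], P (K origin) = c *: K origin.
Proof.
set e := P (K origin); have Me : M e by exact: (proj_in normE).
have evo : ev e origin = (nrm e ^+ 2)%:C.
  by rewrite evE -(dot_nrm normE) -[in LHS](proj_id normE ML Mc Me) proj_self.
pose X i := coord_mul i e; have aX : almost_in X by exact: almost_in_coord_mul.
pose x i := bshift i (X i).
have QX0 : (fun i => nrm (Q (x i))) @ \oo --> (0 : R) by exact: (coproj_null id).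
have limX : (fun i => nrm (X i) ^+ 2) @ \oo --> nrm e ^+ 2.
  apply: cvg_dist_le (cvg0Ml (nrm (K origin)) QX0) => i.
  rewrite -nrm_real rmorphB/= -evo -(bshift_coord_mul_origin i Me).
  rewrite coord_mul_proj_kernel addrAC subrr sub0r nrmN mulrC.
  exact: (nrm_dot_le normE).
(* Since [<x_i, e> = |X_i|^2] and [|x_i| <= |X_i|], expanding the square gives
   [|x_i - e|^2 <= |e|^2 - |X_i|^2]. *)
have x_e : (fun i => nrm (x i - e)) @ \oo --> (0 : R).
  apply: cvg0_sqr => [i|]; first exact: nrm_ge0.
  have lim : (fun i => nrm e ^+ 2 - nrm (X i) ^+ 2) @ \oo --> (0 : R).
    by rewrite -[X in _ --> X](subrr (nrm e ^+ 2)); apply: cvgB => //; exact: cvg_cst.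
  apply: cvg0_le lim => i; rewrite sqr_ge0/= (nrm_sqrB normE).
  have -> : complex.Re '[x i, e] = nrm (X i) ^+ 2.
    by rewrite -coord_mul_dotr// -(nrm_sqr normE).
  have : nrm (x i) ^+ 2 <= nrm (X i) ^+ 2.
    by rewrite ler_pXn2r ?nnegrE ?nrm_ge0// bshift_le.
  by move: (nrm _ ^+ 2) (nrm _ ^+ 2) (nrm _ ^+ 2) => u v w; lra.
(* For [i] different from [l], [|B_l x_i| = |B_i B_l X_i| <= |B_l X_i|], so the row bound at [X_i]
   gives [|x_i|^2 + |B_l x_i|^2 <= |X_i|^2]; both ends have known limits. *)
have Be0 l : bshift l e = 0.
  have limx : (fun i => nrm (x i)) @ \oo --> nrm e by exact: cvg_nrm_dist.
  have limBx : (fun i => nrm (bshift l (x i))) @ \oo --> nrm (bshift l e).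
    apply: cvg_nrm_dist; apply: cvg0_le x_e => i.
    by rewrite nrm_ge0/= -bshiftB bshift_le.
  have : nrm e ^+ 2 + nrm (bshift l e) ^+ 2 <= nrm e ^+ 2.
    have lim : (fun i => nrm (x i) ^+ 2 + nrm (bshift l (x i)) ^+ 2) @ \oo -->
        nrm e ^+ 2 + nrm (bshift l e) ^+ 2.
      by apply: cvgD; rewrite !expr2; exact: cvgM.
    apply: (ler_cvg_to lim limX); exists l.+1 => // i /= li.
    have il : i != l by rewrite gtn_eqF.
    apply: le_trans (bshift_le2 (X i) il); rewrite lerD2l /x bshiftC.
    by rewrite ler_pXn2r ?nnegrE ?nrm_ge0// bshift_le.
  rewrite gerDl => B0; apply: nrm_eq0; apply/eqP.
  by rewrite -sqrf_eq0 eq_le B0 sqr_ge0.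
(* With all backward shifts zero, [bshift_expand] reduces to [e(p) = e(0)], and [K origin] is the
   constant function [1]. *)
exists (ev e origin); apply/eqP; rewrite -subr_eq0 -scaleNr addrC; apply/eqP.
apply: fsupp_ev0 => p N pN; rewrite ev_linear rkhs_kernelE mulNr.
rewrite (@da_kernelE _ 0); last by right; exact: fsupp_origin.
rewrite big_ord0 mul0r addr0 mulr1 (bshift_expand e pN) big1 ?addr0 ?addNr// => l _.
by rewrite Be0 linear0 mulr0.
Qed.

(* The projection of [f] on the orthogonal of [M] vanishes at [origin] with all its
   backward shifts, so it equals its image by the strict contraction [point_shift]. *)
Lemma submodule_origin : M (K origin) -> M = setT.
Proof.
move=> Mo; apply/seteqP; split=> // f _.
have ev_orth u : (forall g, M g -> '[u, g] = 0) -> ev u origin = 0.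
  by move=> uM; rewrite evE uM.
suff : Q f = 0 by move/eqP; rewrite subr_eq0 => /eqP ->; exact: (proj_in normE).
apply: fsupp_ev0 => p N pN; pose u k := iter k (point_shift N p) (Q f).
have uM k g : M g -> '[u k, g] = 0.
  elim: k g => [|k IH] g Mg; first exact: (proj_orth normE).
  by rewrite /= dot_suml big1// => l _; rewrite dotZl bshift_orth ?mulr0.
have S1 := ball_sqsum p N; have S0 := sqsum_ge0 N (\val p).
apply: nrm_eq0; apply/eqP; rewrite eq_le nrm_ge0 andbT.
have lim : (fun k => nrm (Q f) * nrm (K p) * ((1 + sqsum N (\val p)) / 2) ^+ k)
    @ \oo --> (0 : R).
  by apply: cvg0Ml; apply: cvg_expr; rewrite ger0_norm; lra.
apply: cvg_ge_cst lim _ => k.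
rewrite (iter_point_shift_ev k _ pN) big1 ?add0r; last first.
  by move=> j _; exact: (ev_orth _ (uM j)).
rewrite (le_trans (ev_le _ _))// mulrAC ler_wpM2r ?nrm_ge0// mulrC.
exact: iter_point_shift_le.
Qed.

End AlmostInvariant.
End Submodule.

Theorem theorem1p4 (R : realType) (H : drury_arveson R) (M : set H)
  (subM : submodule M) (M_neq0 : M <> [set 0%R]) (rankM : finite_rank M) :
  M = setT.
Proof.
case: rankM => n [D [S DS [Dpos D2]] Ddim].
have null := coproj_bshift_null subM DS Dpos D2 Ddim.
have Ko_neq0 := proj_origin_neq0 subM null M_neq0.
have [c cE] := proj_origin_cst subM null.
apply: (submodule_origin subM).
have [M0 ML] := submodule_linear subM.
have c0 : c != 0.
  by apply/eqP => c0; apply: Ko_neq0; rewrite cE c0 scale0r.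
have := ML c^-1 _ _ (proj_in (@rkhs_normE _ _ _ H) (submodule_linear subM)
  (submodule_closed subM) (rkhs_kernel H (origin R))) M0.
by rewrite cE scalerA mulVf// scale1r addr0.
Qed.
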